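(* Let $k$ be an algebraically closed field, let $G$ be an algebraic group over $k$, $N$ a closed normal subgroup of $G$, $H$ a closed subgroup of $G$ with $N\le H$, $M$ a $G/N$-module, and $E$ and $V$ $G$-modules such that $E$ is finite dimensional. Then $$\mathrm{Ext}^n_{(G/N,\,H/N)}\left(M,\mathrm{Hom}_N(E,V)\right)\cong\mathrm{Ext}^n_{(G,H)}(M\otimes E,V)\quad\text{for all } n\ge0,$$ where on the right $M$ is regarded as a $G$-module via $G\to G/N$.
   Context: Modules are rational modules. $\mathrm{Hom}_N(E,V)$ is a $G/N$-module via the conjugation action of $G$. For an algebraic group $A$ and a closed subgroup $C\le A$: an exact sequence of $A$-modules with differentials $d_i:M_i\to M_{i+1}$ is $(A,C)$-exact if $\mathrm{Ker}(d_i)$ is a direct $C$-module summand of $M_i$ for all $i$. An $A$-module $I$ is $(A,C)$-injective if for every $(A,C)$-exact sequence $0\to M_1\xrightarrow{d_1}M_2\to M_3\to0$ and every $A$-homomorphism $f:M_1\to I$ there is an $A$-homomorphism $h:M_2\to I$ with $f=h\circ d_1$. An $(A,C)$-injective resolution of $X$ is an $(A,C)$-exact sequence $0\to X\to I_0\to I_1\to\cdots$ with all $I_j$ being $(A,C)$-injective; these exist. $\mathrm{Ext}^n_{(A,C)}(Y,X)$ is the $n$-th cohomology of $0\to\mathrm{Hom}_A(Y,I_0)\to\mathrm{Hom}_A(Y,I_1)\to\cdots$ (independent of the resolution). *)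

(* Defs.v *)
From HB Require Import structures.
From mathcomp Require Import freeg mpoly.
From mathcomp Require Import all_boot all_order all_algebra.
From mathcomp Require Import boolp functions.
From mathcomp Require Import monoid.

Set Implicit Arguments.
Unset Strict Implicit.
Unset Printing Implicit Defensive.

Import GRing.Theory.
Local Open Scope ring_scope.
Local Open Scope quotient_scope.

Section Subspaces.
Variables (k : fieldType) (V : lmodType k).

Record subspace := Subspace {
  sp_set :> V -> Prop;
  sp0 : sp_set 0;
  spP : forall a u v, sp_set u -> sp_set v -> sp_set (a *: u + v) }.

Variable W : subspace.

Lemma spD u v : W u -> W v -> W (u + v).
Proof. by move=> Wu Wv; rewrite -[u]scale1r; apply: spP. Qed.

Lemma spZ a u : W u -> W (a *: u).
Proof. by move=> Wu; rewrite -[_ *: _]addr0; apply: spP => //; apply: sp0. Qed.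

Lemma spB u v : W u -> W v -> W (u - v).
Proof. by move=> Wu Wv; rewrite addrC -scaleN1r; apply: spP. Qed.

Lemma sp_sum n (F : 'I_n -> V) : (forall i, W (F i)) -> W (\sum_i F i).
Proof. by move=> WF; elim/big_rec: _ => [|i v _ Wv]; [exact: sp0|exact: spD]. Qed.

Definition sp_pred : {pred V} := fun v => `[< W v >].

Lemma sp_predE v : (v \in sp_pred) = `[< W v >]. Proof. by []. Qed.

Lemma sp_pred_closed : submod_closed sp_pred.
Proof.
split=> [|a u v]; rewrite ?sp_predE; first exact/asboolP/sp0.
by move=> /asboolP Wu /asboolP Wv; apply/asboolP/spP.
Qed.
HB.instance Definition _ := GRing.isSubmodClosed.Build k V sp_pred sp_pred_closed.

Record sp_sort := SpSort { sp_val : V; _ : sp_val \in sp_pred }.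
HB.instance Definition _ := [isSub for sp_val].
HB.instance Definition _ := [Choice of sp_sort by <:].
HB.instance Definition _ := [SubChoice_isSubLmodule of sp_sort by <:].

Lemma sp_valP (x : sp_sort) : W (sp_val x).
Proof. by case: x => x /= /asboolP. Qed.

Definition in_sp v (Wv : W v) : sp_sort := SpSort (introT (asboolP _) Wv).

End Subspaces.

Section QuotientSpace.
Variables (k : fieldType) (V : lmodType k) (W : subspace V).

Definition quo := Quotient.quot (sp_pred W).
HB.instance Definition _ := GRing.Zmodule.on quo.

Definition qclass (v : V) : quo := \pi_quo v.

Lemma qclass_eqP u v : qclass u = qclass v <-> W (u - v).
Proof.
rewrite /qclass; split.
  by move/eqP; rewrite -Quotient.idealrBE => /asboolP.
by move=> Wuv; apply/eqP; rewrite -Quotient.idealrBE; apply/asboolP.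
Qed.

Lemma qclassK (x : quo) : qclass (repr x) = x.
Proof. exact: reprK. Qed.

Lemma qclassD u v : qclass (u + v) = qclass u + qclass v.
Proof. by rewrite /qclass [LHS]raddfD. Qed.

Lemma qclass0 : qclass 0 = 0.
Proof. by rewrite /qclass raddf0. Qed.

Definition quo_scale (a : k) (x : quo) : quo := qclass (a *: repr x).

Lemma qclass_scale a v : quo_scale a (qclass v) = qclass (a *: v).
Proof.
by apply/qclass_eqP; rewrite -scalerBr; apply/spZ/qclass_eqP/qclassK.
Qed.

Lemma quo_scaleA a b x : quo_scale a (quo_scale b x) = quo_scale (a * b) x.
Proof. by rewrite -[x]qclassK !qclass_scale scalerA. Qed.
Lemma quo_scale1 : left_id 1 quo_scale.
Proof. by move=> x; rewrite -[x]qclassK qclass_scale scale1r. Qed.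
Lemma quo_scaleDr : right_distributive quo_scale +%R.
Proof.
move=> a x y; rewrite -[x]qclassK -[y]qclassK -qclassD !qclass_scale.
by rewrite scalerDr qclassD.
Qed.
Lemma quo_scaleDl x : {morph quo_scale^~ x : a b / a + b}.
Proof. by move=> a b; rewrite -[x]qclassK !qclass_scale scalerDl qclassD. Qed.

HB.instance Definition _ := GRing.Zmodule_isLmodule.Build k quo
  quo_scaleA quo_scale1 quo_scaleDr quo_scaleDl.

Lemma qclassZ a v : qclass (a *: v) = a *: qclass v.
Proof. by rewrite -qclass_scale. Qed.

End QuotientSpace.

Arguments qclass {k V} W v.

Section LinearAlgebra.
Variables (k : fieldType) (V : lmodType k).

Lemma span_subproof0 (S : V -> Prop) : forall W : subspace V, (forall v, S v -> W v) -> W 0.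
Proof. by move=> W _; apply: sp0. Qed.
Lemma span_subproofP (S : V -> Prop) a u v :
  (forall W : subspace V, (forall v, S v -> W v) -> W u) ->
  (forall W : subspace V, (forall v, S v -> W v) -> W v) ->
  forall W : subspace V, (forall v, S v -> W v) -> W (a *: u + v).
Proof. by move=> hu hv W SW; apply: spP; [apply: hu|apply: hv]. Qed.
Definition span (S : V -> Prop) : subspace V :=
  Subspace (@span_subproof0 S) (@span_subproofP S).

Definition free_family n (w : 'I_n -> V) : Prop :=
  forall a : 'I_n -> k, \sum_i a i *: w i = 0 -> forall i, a i = 0.

Definition finite_dim : Prop :=
  exists n (w : 'I_n -> V), forall v, exists a : 'I_n -> k, v = \sum_i a i *: w i.

(* The subquotient Z / (Z \cap B) of the ambient space V. *)
Variables Z B : subspace V.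

Lemma subquot_subproof0 : B (sp_val (0 : sp_sort Z)).
Proof. exact: sp0. Qed.
Lemma subquot_subproofP a (u v : sp_sort Z) :
  B (sp_val u) -> B (sp_val v) -> B (sp_val (a *: u + v)).
Proof. by move=> Bu Bv; apply: spP. Qed.
Definition subquot : lmodType k :=
  quo (@Subspace k (sp_sort Z) (fun x => B (sp_val x))
         subquot_subproof0 subquot_subproofP).

End LinearAlgebra.

Definition lmod_iso (k : fieldType) (U V : lmodType k) : Prop :=
  exists f : {linear U -> V}, bijective f.

Section Tensor.
Variables (k : fieldType) (M E : lmodType k).

Definition free_prod : lmodType k := {freeg (M * E)%type / k}.
Definition free_gen (m : M) (e : E) : free_prod := << (m, e) >>.

Inductive tens_rel : free_prod -> Prop :=
| TensRelL a (m m' : M) (e : E) : tens_rel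
    (free_gen (a *: m + m') e - (a *: free_gen m e + free_gen m' e))
| TensRelR a (m : M) (e e' : E) : tens_rel
    (free_gen m (a *: e + e') - (a *: free_gen m e + free_gen m e')).

Definition tens : lmodType k := quo (span tens_rel).
Definition pure (m : M) (e : E) : tens := qclass _ (free_gen m e).

Lemma pure_linearl e : linear (pure^~ e).
Proof.
move=> a m m'; rewrite /pure -qclassZ -qclassD.
by apply/qclass_eqP => W; apply; apply: TensRelL.
Qed.
Lemma pure_linearr m : linear (pure m).
Proof.
move=> a m' e; rewrite /pure -qclassZ -qclassD.
by apply/qclass_eqP => W; apply; apply: TensRelR.
Qed.

Lemma pure_ind (W : subspace tens) : (forall m e, W (pure m e)) -> forall t, W t.
Proof.
move=> Wp t; rewrite -[t]qclassK -[repr t]freeg_sumE.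
elim/big_rec: _ => [|p x _ Wx].
  by rewrite qclass0; apply: sp0.
rewrite qclassD; apply: spD => //.
have -> : Freeg [:: (coeff p (repr t), p)] =
          coeff p (repr t) *: free_gen p.1 p.2.
  apply/eqP/freeg_eqP => q.
  by rewrite coeffZ !coeffU mul1r; case: p.
by rewrite qclassZ; apply/spZ/Wp.
Qed.

Section Lift.
Variables (U : lmodType k) (b : M -> E -> U).

(* The linear map M \otimes E -> U induced by b, meaningful for b bilinear. *)
Definition free_lift : free_prod -> U := fglift (fun p => b p.1 p.2).
Definition tens_lift (t : tens) : U := free_lift (repr t).

Hypothesis b_linearl : forall e, linear (b^~ e).
Hypothesis b_linearr : forall m, linear (b m).

Lemma free_lift_linear : linear free_lift.
Proof.
have add : {morph free_lift : x y / x + y}.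
  have sub : {morph free_lift : x y / x - y} by exact: lift_is_additive.
  move=> x y; have s0 : free_lift 0 = 0 by rewrite -(subrr 0) sub subrr.
  by rewrite -{1}[y]opprK sub -[- y]sub0r sub s0 sub0r opprK.
move=> a x y; rewrite add; congr (_ + _).
rewrite -[x]freeg_sumE.
elim/big_rec: _ => [|p z _ IH].
  by rewrite scaler0 (_ : free_lift 0 = 0) ?scaler0 //;
     apply: (addrI (free_lift 0)); rewrite -add !addr0.
rewrite scalerDr !add IH scalerDr; congr (_ + _).
have -> : a *: Freeg [:: (coeff p x, p)] =
          Freeg [:: (a * coeff p x, p)] :> free_prod.
  by apply/eqP/freeg_eqP => q; rewrite coeffZ !coeffU mulrA.
by rewrite /free_lift !liftU scalerA.
Qed.

Lemma tens_lift_class x : tens_lift (qclass _ x) = free_lift x.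
Proof.
have k0 : free_lift 0 = 0.
  by have := free_lift_linear (-1) 0 0; rewrite scaler0 addr0 scaleN1r addNr.
have kP a u v : free_lift u = 0 -> free_lift v = 0 -> free_lift (a *: u + v) = 0.
  by move=> hu hv; rewrite free_lift_linear hu hv scaler0 addr0.
have genE m e : free_lift (free_gen m e) = b m e.
  by rewrite /free_lift liftU scale1r.
have subE u v : free_lift (u - v) = free_lift u - free_lift v.
  by rewrite addrC -scaleN1r free_lift_linear scaleN1r addrC.
apply/eqP; rewrite -subr_eq0 -subE; apply/eqP.
have /qclass_eqP := qclassK (qclass (span tens_rel) x).
move=> /(_ (@Subspace k free_prod (fun x => free_lift x = 0) k0 kP)); apply.
by move=> _ [a m m' e|a m e e'] /=;
  rewrite subE free_lift_linear !genE (b_linearl, b_linearr) subrr.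
Qed.

Lemma tens_lift_linear : linear tens_lift.
Proof.
move=> a x y; rewrite -[x]qclassK -[y]qclassK -qclassZ -qclassD !tens_lift_class.
exact: free_lift_linear.
Qed.

Lemma tens_lift_pure m e : tens_lift (pure m e) = b m e.
Proof. by rewrite tens_lift_class /free_lift liftU scale1r. Qed.
End Lift.
End Tensor.

Arguments pure {k M E} m e.

Lemma linear_comb (k : fieldType) (U V : lmodType k) (f : U -> V) (I : finType)
    (a : I -> k) (u : I -> U) :
  linear f -> f (\sum_i a i *: u i) = \sum_i a i *: f (u i).
Proof.
move=> lf; have f0 : f 0 = 0.
  by have := lf (-1) 0 0; rewrite scaler0 addr0 scaleN1r addNr.
by elim/big_rec2: _ => // i y1 y2 _ <-; rewrite lf.
Qed.

Section FiniteFunctions.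
Variables (k : fieldType) (T : Type).
Implicit Type P : (T -> k) -> Prop.

Definition lin_closed P : Prop :=
  P (fun=> 0) /\
  forall a f g, P f -> P g -> P (fun t => a * f t + g t).

Lemma lin_closed_sum P (I : finType) (a : I -> k) (f : I -> T -> k) :
  lin_closed P -> (forall i, P (f i)) -> P (fun t => \sum_i a i * f i t).
Proof.
move=> [P0 PP] Pf.
suff H (s : seq I) : P (fun t => \sum_(i <- s) a i * f i t) by apply: H.
elim: s => [|i s IH].
  by rewrite (_ : (fun _ => _) = fun=> 0) //; apply/funext => t; rewrite big_nil.
rewrite (_ : (fun _ => _) = fun t => a i * f i t + \sum_(j <- s) a j * f j t).
  exact: PP.
by apply/funext => t; rewrite big_cons.
Qed.

Lemma dual_points n (f : 'I_n -> T -> k) :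
  exists m (h : 'I_m -> T -> k) (p : 'I_m -> T),
  [/\ forall P, lin_closed P -> (forall i, P (f i)) -> forall l, P (h l),
      forall l l', h l (p l') = (l == l')%:R &
      forall j x, f j x = \sum_l f j (p l) * h l x].
Proof.
elim: n f => [|n IH] f.
  by exists 0, (fun=> fun=> 0), (ffun0 (card_ord 0)); split; [move=> ? ? ? []|case|case].
have [m [h [p [hP hp hf]]]] := IH (fun i => f (lift ord0 i)).
pose r0 x := f ord0 x - \sum_l f ord0 (p l) * h l x.
have r0p l : r0 (p l) = 0.
  rewrite /r0 (bigD1 l) //= hp eqxx mulr1 big1 ?addr0 ?subrr // => i il.
  by rewrite hp (negPf il) mulr0.
have Pr0 P : lin_closed P -> (forall i, P (f i)) -> P r0.
  move=> lP Pf.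
  have -> : r0 = fun t => (-1) * (\sum_l f ord0 (p l) * h l t) + f ord0 t.
    by apply/funext => t; rewrite mulN1r addrC.
  apply: lP.2 => //; apply: lin_closed_sum => // l; apply: hP => //.
have [[x0 r0x]|nr0] := pselect (exists x0, r0 x0 != 0); last first.
  have r00 x : r0 x = 0.
    by apply/eqP; apply: contrapT => H; apply: nr0; exists x; apply/negP.
  exists m, h, p; split => //.
  - by move=> P lP Pf l; apply: hP => // i.
  - move=> j x; case: (unliftP ord0 j) => [j' ->|->]; first exact: hf.
    by apply/eqP; rewrite -subr_eq0; apply/eqP; apply: r00.
pose r x := (r0 x0)^-1 * r0 x.
have rx : r x0 = 1 by rewrite /r mulVf.
have rp l : r (p l) = 0 by rewrite /r r0p mulr0.
exists m.+1,
  (fun l x => if unlift ord0 l is Some l' then h l' x - h l' x0 * r x else r x),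
  (fun l => if unlift ord0 l is Some l' then p l' else x0).
split.
- move=> P lP Pf l.
  have Pr : P r.
    have -> : r = fun t => (r0 x0)^-1 * r0 t + 0 by apply/funext => t; rewrite addr0.
    by apply: lP.2; [exact: Pr0|exact: lP.1].
  case: (unlift ord0 l) => [l'|//].
  have -> : (fun x => h l' x - h l' x0 * r x) = (fun x => (- h l' x0) * r x + h l' x).
    by apply/funext => x; rewrite mulNr addrC.
  by apply: lP.2 => //; apply: hP => // i.
- move=> l l'.
  case: (unliftP ord0 l) => [i ->|->]; case: (unliftP ord0 l') => [j ->|->].
  + by rewrite hp rp mulr0 subr0 (inj_eq (lift_inj (h := _))).
  + by rewrite rx mulr1 subrr.
  + by rewrite rp.
  + by rewrite rx.
move=> j x; rewrite big_ord_recl unlift_none.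
under eq_bigr do rewrite liftK.
have E : \sum_l f j (p l) * (h l x - h l x0 * r x) =
   \sum_l f j (p l) * h l x - (\sum_l f j (p l) * h l x0) * r x.
  by rewrite mulr_suml -sumrB; apply: eq_bigr => l _; rewrite mulrBr mulrA.
rewrite E; case: (unliftP ord0 j) => [j' ->|->].
  by rewrite -!hf addrC subrK.
have -> : f ord0 x0 = r0 x0 + \sum_l f ord0 (p l) * h l x0 by rewrite subrK.
rewrite mulrDl /r mulrA mulfV // mul1r {1}/r0.
set u := \sum_l _ * h l x; set v := _ * (_ * _).
by rewrite [u - v]addrC addrA addrK subrK.
Qed.

Variable V : lmodType k.
Implicit Type F : T -> V.

(* F belongs to the image of P \otimes V in the space of functions T -> V. *)
Definition rfin P F : Prop :=
  exists (I : finType) (f : I -> T -> k) (w : I -> V),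
    (forall i, P (f i)) /\ forall t, F t = \sum_i f i t *: w i.

Lemma rfin0 P : rfin P (fun=> 0).
Proof.
exists 'I_0, (fun=> fun=> 0), (fun=> 0).
by split=> [[]//|t]; rewrite big_ord0.
Qed.

Lemma rfinD P F1 F2 : rfin P F1 -> rfin P F2 -> rfin P (fun t => F1 t + F2 t).
Proof.
move=> [I [f [w [Pf fE]]]] [J [g [u [Pg gE]]]].
exists (I + J)%type,
  (fun i => match i with inl i => f i | inr i => g i end),
  (fun i => match i with inl i => w i | inr i => u i end); split; first by case.
by move=> t; rewrite big_sumType /= fE gE.
Qed.

Lemma rfinZ P a F : rfin P F -> rfin P (fun t => a *: F t).
Proof.
move=> [I [f [w [Pf fE]]]]; exists I, f, (fun i => a *: w i); split => // t.
by rewrite fE scaler_sumr; apply: eq_bigr => i _; rewrite !scalerA mulrC.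
Qed.

Lemma rfin_free P F : lin_closed P -> rfin P F ->
  exists n (f : 'I_n -> T -> k) (w : 'I_n -> V),
  [/\ forall i, P (f i), free_family w & forall t, F t = \sum_i f i t *: w i].
Proof.
move=> lP [I [f [w [Pf fE]]]].
have {I f w Pf fE} : exists n (f : 'I_n -> T -> k) (w : 'I_n -> V),
    (forall i, P (f i)) /\ forall t, F t = \sum_i f i t *: w i.
  exists #|I|, (fun i => f (enum_val i)), (fun i => w (enum_val i)).
  split=> // t; rewrite fE.
  by rewrite -(big_enum_val (A := I) (fun i => f i t *: w i)); apply: eq_bigl => i.
move=> [n [f [w [Pf fE]]]]; elim: n => [|n IH] in f w Pf fE *.
  by exists 0, f, w; split=> // a _ [].
have [fw|nfw] := pselect (free_family w); first by exists n.+1, f, w.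
have [a [wa [i ai]]] : exists a : 'I_n.+1 -> k,
    \sum_i a i *: w i = 0 /\ exists i, a i != 0.
  apply: contrapT => H; apply: nfw => a wa i; apply: contrapT => /eqP ai.
  by apply: H; exists a; split=> //; exists i.
have wi : w i = - \sum_j (a (lift i j) / a i) *: w (lift i j).
  move: wa; rewrite (bigD1_ord i) //= => /(congr1 (fun x => (a i)^-1 *: x)).
  rewrite scalerDr scaler0 scalerA mulVf // scale1r => /eqP.
  rewrite addr_eq0 => /eqP ->; rewrite scaler_sumr; congr (- _).
  by apply: eq_bigr => j _; rewrite scalerA mulrC.
apply: (IH (fun j t => - (a (lift i j) / a i) * f i t + f (lift i j) t)
           (fun j => w (lift i j))).
  by move=> j; apply: lP.2.
move=> t; rewrite fE (bigD1_ord i) //= wi scalerN scaler_sumr -sumrN -big_split /=.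
by apply: eq_bigr => j _; rewrite scalerDl mulNr scaleNr scalerA [f i t * _]mulrC.
Qed.

Lemma rfin_orbit P F : lin_closed P -> rfin P F ->
  exists n (h : 'I_n -> T -> k) (p : 'I_n -> T),
  [/\ forall i, P (h i), free_family (fun i => F (p i)) &
      forall t, F t = \sum_i h i t *: F (p i)].
Proof.
move=> lP /(rfin_free lP) [n [f [w [Pf fw FE]]]].
have [m [h [p [hP hp hf]]]] := dual_points f.
exists m, h, p; split; first by move=> i; apply: hP.
  move=> a Fa l.
  pose Q (phi : T -> k) := \sum_i a i * phi (p i) = 0.
  have lQ : lin_closed Q.
    split=> [|b u v Qu Qv]; rewrite /Q; first by rewrite big1 // => i _; rewrite mulr0.
    under eq_bigr do rewrite mulrDr mulrCA.
    by rewrite big_split /= -mulr_sumr Qu Qv mulr0 addr0.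
  have Qf i : Q (f i).
    apply: (fw (fun j => \sum_i a i * f j (p i))); rewrite -[RHS]Fa.
    under [LHS]eq_bigr do rewrite scaler_suml.
    under [RHS]eq_bigr do rewrite FE scaler_sumr.
    rewrite exchange_big; apply: eq_bigr => j _; apply: eq_bigr => j' _.
    by rewrite scalerA.
  have := hP Q lQ Qf l; rewrite /Q (bigD1 l) //= hp eqxx mulr1 big1 ?addr0 // => i il.
  by rewrite hp eq_sym (negPf il) mulr0.
move=> t; rewrite FE.
under [RHS]eq_bigr do rewrite FE scaler_sumr.
rewrite exchange_big; apply: eq_bigr => j _; rewrite hf scaler_suml.
by apply: eq_bigr => i _; rewrite scalerA mulrC.
Qed.

End FiniteFunctions.

Lemma finite_dim_basis (k : fieldType) (E : lmodType k) : finite_dim E ->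
  exists n (e : 'I_n -> E) (c : 'I_n -> E -> k),
    (forall i a x y, c i (a *: x + y) = a * c i x + c i y) /\
    forall x, x = \sum_i c i x *: e i.
Proof.
move=> [n [w spanw]].
have lT : lin_closed (fun _ : E -> k => True) by [].
have /(rfin_free lT) : rfin (fun _ : E -> k => True) (@id E).
  have [a aE] := choice spanw.
  by exists 'I_n, (fun i x => a x i), w.
move=> [m [c [e [_ fe cE]]]]; exists m, e, c; split=> // i a x y.
apply/eqP; rewrite -subr_eq0; apply/eqP; move: i.
apply: fe; under eq_bigr do rewrite scalerBl scalerDl -scalerA.
by rewrite sumrB big_split /= -scaler_sumr -!cE subrr.
Qed.

(* A group together with a space of k-valued functions on it, its regular
   functions.  Affine algebraic groups are singled out by [affine_group] below.
   Rational modules and relative Ext groups only depend on this structure, which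
   the quotient G/N inherits; that G/N is again affine is not needed to state
   anything about its modules. *)
Record fgroup (k : closedFieldType) := FGroup {
  fg_sort :> groupType;
  regular : (fg_sort -> k) -> Prop }.

(* A is a Zariski closed subset of an affine space k^n, the regular functions
   being the restrictions of polynomials, and multiplication and inversion are
   polynomial maps. *)
Definition affine_group (k : closedFieldType) (A : fgroup k) : Prop :=
  exists n (x : A -> 'I_n -> k),
  [/\ injective x,
      exists S : {mpoly k[n]} -> Prop, forall a : 'I_n -> k,
        (exists g, x g = a) <-> (forall p, S p -> p.@[a] = 0),
      forall f : A -> k, regular f <-> exists p : {mpoly k[n]}, forall g, f g = p.@[x g],
      forall i, exists p : {mpoly k[n + n]}, forall g h, x (g * h)%g i =
        p.@[fun j => match fintype.split j with inl j => x g j | inr j => x h j end] &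
      forall i, exists p : {mpoly k[n]}, forall g, x (g^-1)%g i = p.@[x g]].

Record algGroup (k : closedFieldType) := AlgGroup {
  ag_fgroup :> fgroup k;
  ag_affine : affine_group ag_fgroup }.

Section RegularFunctions.
Variables (k : closedFieldType) (G : algGroup k).
Implicit Types f : G -> k.

Lemma regular_lin : lin_closed (@regular k G).
Proof.
have [n [x [_ _ reg _ _]]] := ag_affine G.
split=> [|a f g /reg [p pE] /reg [q qE]]; apply/reg.
  by exists 0 => g; rewrite meval0.
by exists (a *: p + q) => t; rewrite mevalD mevalZ pE qE.
Qed.

Lemma regularM f g : regular f -> regular g -> regular (fun t => f t * g t).
Proof.
have [n [x [_ _ reg _ _]]] := ag_affine G.
move=> /reg [p pE] /reg [q qE]; apply/reg.
by exists (p * q) => t; rewrite mevalM pE qE.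
Qed.

Lemma regularV f : regular f -> regular (fun t => f (t^-1)%g).
Proof.
have [n [x [_ _ reg _ inv]]] := ag_affine G.
move=> /reg [p pE]; apply/reg; have [q qE] := choice inv.
exists (comp_mpoly [tuple q i | i < n] p) => t.
rewrite comp_mpoly_meval pE; apply: meval_eq => i.
by rewrite tnth_mktuple qE.
Qed.

Lemma regularR f h : regular f -> regular (fun t => f (t * h)%g).
Proof.
have [n [x [_ _ reg mul _]]] := ag_affine G.
move=> /reg [p pE]; apply/reg; have [q qE] := choice mul.
pose s : (n + n).-tuple {mpoly k[n]} :=
  [tuple match fintype.split j with inl j => 'X_j | inr j => (x h j)%:MP end | j < n + n].
exists (comp_mpoly [tuple comp_mpoly s (q i) | i < n] p) => t.
rewrite comp_mpoly_meval pE; apply: meval_eq => i.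
rewrite tnth_mktuple comp_mpoly_meval qE; apply: meval_eq => j.
by rewrite tnth_mktuple; case: (fintype.split j) => j'; rewrite ?mevalXU ?mevalC.
Qed.

End RegularFunctions.

Section Subgroups.
Variables (k : closedFieldType) (A : fgroup k).

Record closed_subgroup := ClosedSubgroup {
  cs_set :> A -> Prop;
  cs_1 : cs_set 1%g;
  cs_M : forall g h, cs_set g -> cs_set h -> cs_set (g * h)%g;
  cs_V : forall g, cs_set g -> cs_set (g^-1)%g;
  cs_closed : exists S : (A -> k) -> Prop,
    (forall f, S f -> regular f) /\
    forall g, cs_set g <-> forall f, S f -> f g = 0 }.

Record normal_subgroup := NormalSubgroup {
  ns_sub :> closed_subgroup;
  ns_J : forall g n, ns_sub n -> ns_sub (g^-1 * n * g)%g }.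

End Subgroups.

Section QuotientGroup.
Variables (k : closedFieldType) (G : fgroup k) (N : normal_subgroup G).
Local Open Scope group_scope.

Definition coset_rel (x y : G) : bool := `[< N (x^-1 * y) >].

Lemma coset_rel_equiv : equiv_class_of coset_rel.
Proof.
split=> [x|x y|y x z]; rewrite /coset_rel.
- by rewrite mulVg; apply/asboolP/cs_1.
- by apply/asboolP/asboolP => /cs_V; rewrite invgM invgK.
- move=> /asboolP Nxy /asboolP Nyz; apply/asboolP.
  by rewrite -[x^-1](mulgK y) -mulgA; apply: cs_M.
Qed.
Canonical coset_equiv := EquivRelPack coset_rel_equiv.
Canonical coset_encModRel := defaultEncModRel coset_rel.

Definition cosets := {eq_quot coset_rel}.
HB.instance Definition _ : EqQuotient G coset_rel cosets := EqQuotient.on cosets.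
HB.instance Definition _ := Choice.on cosets.

Definition coset (x : G) : cosets := \pi_cosets x.

Lemma coset_eqP x y : coset x = coset y <-> N (x^-1 * y).
Proof.
split=> [/eqP|Nxy]; first by rewrite /coset eqmodE => /asboolP.
by apply/eqP; rewrite /coset eqmodE; apply/asboolP.
Qed.

Lemma cosetK (X : cosets) : coset (repr X) = X.
Proof. exact: reprK. Qed.

Definition coset_mul (X Y : cosets) := coset (repr X * repr Y).
Definition coset_inv (X : cosets) := coset (repr X)^-1.

Lemma coset_mulE x y : coset_mul (coset x) (coset y) = coset (x * y).
Proof.
have /coset_eqP Nx := cosetK (coset x); have /coset_eqP Ny := cosetK (coset y).
apply/coset_eqP; set x' := repr _ in Nx *; set y' := repr _ in Ny *.
have -> : (x' * y')^-1 * (x * y) = (y'^-1 * (x'^-1 * x) * y') * (y'^-1 * y).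
  by rewrite invgM !mulgA mulgK.
by apply: cs_M => //; apply: ns_J.
Qed.

Lemma coset_invE x : coset_inv (coset x) = coset x^-1.
Proof.
have /coset_eqP Nx := cosetK (coset x).
apply/coset_eqP; set x' := repr _ in Nx *; rewrite invgK.
have -> : x' * x^-1 = x'^-1^-1 * (x'^-1 * x)^-1 * x'^-1.
  by rewrite invgM !invgK !mulgA mulgK.
by apply/ns_J/cs_V.
Qed.

Lemma coset_mulA : associative coset_mul.
Proof.
by move=> X Y Z; rewrite -[X]cosetK -[Y]cosetK -[Z]cosetK !coset_mulE mulgA.
Qed.
Lemma coset_mul1 : left_id (coset 1) coset_mul.
Proof. by move=> X; rewrite -[X]cosetK coset_mulE mul1g. Qed.
Lemma coset_mulr1 : right_id (coset 1) coset_mul.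
Proof. by move=> X; rewrite -[X]cosetK coset_mulE mulg1. Qed.
Lemma coset_mulV : left_inverse (coset 1) coset_inv coset_mul.
Proof. by move=> X; rewrite -[X]cosetK coset_invE coset_mulE mulVg. Qed.
Lemma coset_mulrV : right_inverse (coset 1) coset_inv coset_mul.
Proof. by move=> X; rewrite -[X]cosetK coset_invE coset_mulE mulgV. Qed.

HB.instance Definition _ := isGroup.Build cosets
  coset_mulA coset_mul1 coset_mulr1 coset_mulV coset_mulrV.

(* k[G/N] = k[G]^N: a function on G/N is regular when its pullback to G is. *)
Definition quot_group : fgroup k :=
  @FGroup k cosets (fun f => regular (fun x => f (coset x))).

Definition to_quot (x : G) : quot_group := coset x.

Lemma to_quotM x y : to_quot (x * y) = to_quot x * to_quot y.
Proof. exact: esym (coset_mulE x y). Qed.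
Lemma to_quot1 : to_quot 1 = 1.
Proof. by []. Qed.

Definition quot_subgroup (H : closed_subgroup G) (X : quot_group) : Prop :=
  exists2 h, H h & to_quot h = X.

End QuotientGroup.

Arguments quot_subgroup {k G} N H X.

(* Every vector lies in a finite dimensional stable subspace, with basis w, on
   which the matrix coefficients c i j of the action are regular functions. *)
Definition rational (k : closedFieldType) (A : fgroup k) (V : lmodType k)
    (act : A -> V -> V) : Prop :=
  forall v, exists n (w : 'I_n -> V) (c : 'I_n -> 'I_n -> A -> k),
  [/\ free_family w,
      exists a : 'I_n -> k, v = \sum_i a i *: w i,
      forall i j, regular (c i j) &
      forall g j, act g (w j) = \sum_i c i j g *: w i].

Record rmodule (k : closedFieldType) (A : fgroup k) := RModule {
  rm_sort :> lmodType k;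
  act : A -> rm_sort -> rm_sort;
  act_linear : forall g, linear (act g);
  act1 : forall v, act 1%g v = v;
  actM : forall g h v, act (g * h)%g v = act g (act h v);
  act_rational : rational act }.

Section Rational.
Variables (k : closedFieldType) (A : fgroup k) (V : lmodType k).
Variable act : A -> V -> V.

Lemma rational_rfin : lin_closed (@regular k A) -> (forall g, linear (act g)) ->
  rational act -> forall v, rfin (@regular k A) (act^~ v).
Proof.
move=> lA lact ract v; have [n [w [c [_ [a vE] Rc cE]]]] := ract v.
exists 'I_n, (fun i g => \sum_j a j * c i j g), w.
split=> [i|g]; first exact: lin_closed_sum.
rewrite vE linear_comb //.
under eq_bigr do rewrite cE scaler_sumr.
rewrite exchange_big; apply: eq_bigr => i _; rewrite scaler_suml.
by apply: eq_bigr => j _; rewrite scalerA.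
Qed.

Lemma rfin_rational : lin_closed (@regular k A) ->
  (forall f h, regular f -> regular (fun g : A => f (g * h)%g)) ->
  (forall v, act 1%g v = v) ->
  (forall g h v, act (g * h)%g v = act g (act h v)) ->
  (forall v, rfin (@regular k A) (act^~ v)) -> rational act.
Proof.
move=> lA RA a1 aM fA v; have [n [h [p [Rh fp hE]]]] := rfin_orbit lA (fA v).
exists n, (fun i => act (p i) v), (fun i j g => h i (g * p j)%g); split=> //.
- by exists (fun i => h i 1%g); rewrite -hE a1.
- by move=> i j; apply: RA.
- by move=> g j; rewrite -aM hE.
Qed.

End Rational.

Section HomSpace.
Variables (k : closedFieldType) (A : fgroup k).

Lemma act_rfin (G : algGroup k) (X : rmodule G) v : rfin (@regular k G) (@act _ _ X ^~ v).
Proof.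
by apply: rational_rfin;
  [exact: regular_lin|exact: act_linear|exact: act_rational].
Qed.

Variables (C : A -> Prop) (X Y : rmodule A).

Definition equivariant (f : X -> Y) : Prop :=
  forall c, C c -> forall x, f (act c x) = act c (f x).

Lemma act_0 (Z : rmodule A) g : act g (0 : Z) = 0.
Proof. by have := act_linear g (-1) (0 : Z) 0; rewrite scaler0 addr0 scaleN1r addNr. Qed.

Lemma hom_subproof0 : linear (0 : X -> Y) /\ equivariant 0.
Proof.
split=> [a u v|c _ x]; last by rewrite [RHS]act_0.
by rewrite [RHS]addr0 [RHS]scaler0.
Qed.

Lemma hom_subproofP a (f g : X -> Y) :
  linear f /\ equivariant f -> linear g /\ equivariant g ->
  linear (a *: f + g) /\ equivariant (a *: f + g).
Proof.
move=> [lf ef] [lg eg]; split=> [b u v|c Cc x] /=.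
  rewrite !fctE lf lg /= !scalerDr !scalerA [b * a]mulrC -!addrA; congr (_ + _).
  by rewrite addrCA.
by rewrite !fctE ef // eg // act_linear.
Qed.

(* Hom_C(X, Y), as a subspace of the space of all functions X -> Y. *)
Definition hom_over : subspace (X -> Y) :=
  @Subspace k (X -> Y : lmodType k)
    (fun f => linear f /\ equivariant f) hom_subproof0 hom_subproofP.

End HomSpace.

Definition hom (k : closedFieldType) (A : fgroup k) (X Y : rmodule A) :
  subspace (X -> Y) := hom_over (fun=> True) X Y.

Section Inflation.
Variables (k : closedFieldType) (G : algGroup k) (N : normal_subgroup G).
Variable M : rmodule (quot_group N).

Lemma inflate_rational : rational (fun (g : G) (m : M) => act (to_quot N g) m).
Proof.
move=> v; have [n [w [c [fw aE Rc cE]]]] := act_rational (r := M) v.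
exists n, w, (fun i j g => c i j (to_quot N g)); split=> // g j; exact: cE.
Qed.

Definition inflate : rmodule G.
refine (@RModule k G M (fun g m => act (to_quot N g) m) _ _ _ inflate_rational).
- by move=> g; apply: act_linear.
- by move=> v; rewrite to_quot1 act1.
- by move=> g h v; rewrite to_quotM actM.
Defined.

End Inflation.

Section TensorModule.
Variables (k : closedFieldType) (G : algGroup k) (M E : rmodule G).

Definition tens_act (g : G) : tens M E -> tens M E :=
  tens_lift (fun m e => pure (act g m) (act g e)).

Let linl g e : linear (fun m : M => pure (act g m) (act g e : E)).
Proof. by move=> a u v; rewrite act_linear pure_linearl. Qed.
Let linr g m : linear (fun e : E => pure (act g m : M) (act g e)).
Proof. by move=> a u v; rewrite act_linear pure_linearr. Qed.

Lemma tens_act_pure g m e : tens_act g (pure m e) = pure (act g m) (act g e).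
Proof. exact: tens_lift_pure. Qed.

Lemma tens_act_linear g : linear (tens_act g).
Proof. exact: tens_lift_linear. Qed.

Lemma tens_act0 g : tens_act g 0 = 0.
Proof. by have := tens_act_linear g (-1) 0 0; rewrite scaler0 addr0 scaleN1r addNr. Qed.

Lemma tens_act1 t : tens_act 1%g t = t.
Proof.
have WP a u v : tens_act 1%g u = u -> tens_act 1%g v = v ->
    tens_act 1%g (a *: u + v) = a *: u + v.
  by move=> hu hv; rewrite tens_act_linear hu hv.
apply: (pure_ind (W := Subspace (tens_act0 1%g) WP)) => m e /=.
by rewrite tens_act_pure !act1.
Qed.

Lemma tens_actM g h t : tens_act (g * h)%g t = tens_act g (tens_act h t).
Proof.
pose P t := tens_act (g * h)%g t = tens_act g (tens_act h t).
have W0 : P 0 by rewrite /P !tens_act0.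
have WP a u v : P u -> P v -> P (a *: u + v).
  by rewrite /P => hu hv; rewrite !tens_act_linear hu hv.
apply: (pure_ind (W := Subspace W0 WP)) => m e.
by rewrite /= /P !tens_act_pure !actM.
Qed.

Lemma tens_act_rational : rational tens_act.
Proof.
apply: rfin_rational; [exact: regular_lin|exact: regularR|exact: tens_act1|
  exact: tens_actM|].
pose P t := rfin (@regular k G) (tens_act^~ t).
have W0 : P 0.
  rewrite /P (_ : (fun _ => _) = fun=> 0); first exact: rfin0.
  by apply/funext => g; rewrite tens_act0.
have WP a u v : P u -> P v -> P (a *: u + v).
  move=> hu hv; rewrite /P (_ : (fun _ => _) = fun g => a *: tens_act g u + tens_act g v).
    by apply: rfinD => //; apply: rfinZ.
  by apply/funext => g; rewrite tens_act_linear.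
apply: (pure_ind (W := Subspace W0 WP)) => m e; rewrite /= /P.
have [I [f [u [Rf fE]]]] := act_rfin m; have [J [h [v [Rh hE]]]] := act_rfin e.
exists (I * J)%type, (fun p g => f p.1 g * h p.2 g), (fun p => pure (u p.1) (v p.2)).
split=> [p|g]; first exact: regularM.
rewrite tens_act_pure fE hE.
rewrite -(pair_bigA _ (fun i j => (f i g * h j g) *: pure (u i) (v j))) /=.
rewrite (linear_comb _ _ (@pure_linearl _ M E _)).
apply: eq_bigr => i _; rewrite (linear_comb _ _ (@pure_linearr _ M E _)) scaler_sumr.
by apply: eq_bigr => j _; rewrite scalerA.
Qed.

Definition tensor : rmodule G :=
  RModule tens_act_linear tens_act1 tens_actM tens_act_rational.

End TensorModule.

Section HomModule.
Variables (k : closedFieldType) (G : algGroup k) (N : normal_subgroup G).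
Variables (E V : rmodule G).

Local Notation homN := (sp_sort (hom_over N E V)).

Definition conj_fun (g : G) (f : E -> V) : E -> V :=
  fun e => act g (f (act (g^-1)%g e)).

Lemma conj_homN g f : hom_over N E V f -> hom_over N E V (conj_fun g f).
Proof.
move=> [lf ef]; split=> [a u v|n Nn e]; rewrite /conj_fun.
  by rewrite act_linear lf act_linear.
have -> : act n (act g (f (act (g^-1)%g e))) =
          act g (act (g^-1 * n * g)%g (f (act (g^-1)%g e))).
  by rewrite -!actM !mulgA mulgV mul1g.
congr (act g _); rewrite -ef; last exact: ns_J.
by rewrite -!actM -!mulgA mulgV mulg1.
Qed.

Definition conj_act (g : G) (f : homN) : homN :=
  in_sp (conj_homN g (sp_valP f)).

Definition homN_act (X : quot_group N) (f : homN) : homN := conj_act (repr X) f.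

Lemma conj_act1 f : conj_act 1%g f = f.
Proof.
by apply/val_inj/funext => e; rewrite /= /conj_fun invg1 !act1.
Qed.

Lemma conj_actM g h f : conj_act (g * h)%g f = conj_act g (conj_act h f).
Proof.
by apply/val_inj/funext => e; rewrite /= /conj_fun invgM !actM.
Qed.

Lemma conj_act_linear g : linear (conj_act g).
Proof.
move=> a u v; apply/val_inj/funext => e.
exact: (act_linear g a (sp_val u (act g^-1%g e)) (sp_val v (act g^-1%g e))).
Qed.

Lemma conj_actN n f : N n -> conj_act n f = f.
Proof.
move=> Nn; apply/val_inj/funext => e; rewrite /= /conj_fun.
have [_ ef] := sp_valP f; rewrite ef; last exact: cs_V.
by rewrite -actM mulgV act1.
Qed.

Lemma homN_actE g f : homN_act (to_quot N g) f = conj_act g f.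
Proof.
have /coset_eqP Ng := cosetK (to_quot N g).
rewrite /homN_act; set g' := repr _ in Ng *.
by rewrite -[g](mulVKg g') conj_actM (conj_actN _ Ng).
Qed.

Lemma homN_act_linear X : linear (homN_act X).
Proof. exact: conj_act_linear. Qed.
Lemma homN_act1 f : homN_act 1%g f = f.
Proof. by rewrite -to_quot1 homN_actE conj_act1. Qed.
Lemma homN_actM X Y f : homN_act (X * Y)%g f = homN_act X (homN_act Y f).
Proof.
rewrite -[X]cosetK -[Y]cosetK -[coset N _ : quot_group N]/(to_quot N _).
by rewrite -[coset N _]/(to_quot N _) -to_quotM !homN_actE conj_actM.
Qed.

Hypothesis finE : finite_dim E.

Lemma conj_rfin (f : homN) : rfin (@regular k G) (fun g => sp_val (conj_act g f)).
Proof.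
have [n [e [c [clin cE]]]] := finite_dim_basis finE.
have c0 i : c i 0 = 0 by have := clin i (-1) 0 0; rewrite scaler0 addr0 mulN1r addNr.
have csum i (J : finType) (a : J -> k) (x : J -> E) :
    c i (\sum_j a j *: x j) = \sum_j a j * c i (x j).
  by elim/big_rec2: _ => [|j y1 y2 _ <-]; rewrite ?c0 ?clin.
have [lf _] := sp_valP f.
have Rc i j : regular (fun g : G => c i (act (g^-1)%g (e j))).
  apply: (@regularV _ _ (fun g => c i (act g (e j)))).
  have [J [h [u [Rh hE]]]] := act_rfin (e j).
  rewrite (_ : (fun _ => _) = fun g => \sum_l c i (u l) * h l g).
    by apply: lin_closed_sum => //; exact: regular_lin.
  by apply/funext => g; rewrite hE csum; apply: eq_bigr => l _; rewrite mulrC.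
have E1 g x : sp_val (conj_act g f) x =
   \sum_j \sum_i (c i (act (g^-1)%g (e j))) *: (c j x *: act g (sp_val f (e i))).
  have lact := @act_linear k G.
  rewrite /= /conj_fun {1}[x]cE (linear_comb _ _ (lact E _)) (linear_comb _ _ lf).
  rewrite (linear_comb _ _ (lact V _)); apply: eq_bigr => j _.
  rewrite {1}[act g^-1 (e j)]cE (linear_comb _ _ lf) (linear_comb _ _ (lact V _)).
  by rewrite scaler_sumr; apply: eq_bigr => i _; rewrite !scalerA mulrC.
have hE i : rfin (@regular k G) (fun g : G => act g (sp_val f (e i))) by exact: act_rfin.
have sumR (I : finType) (F : I -> G -> E -> V) :
  (forall i, rfin (@regular k G) (F i)) -> rfin (@regular k G) (fun g => \sum_i F i g).
  move=> RF; suff H (s : seq I) : rfin (@regular k G) (fun g => \sum_(i <- s) F i g).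
    exact: H.
  elim: s => [|i s IH].
    rewrite (_ : (fun _ => _) = fun=> 0); first exact: rfin0.
    by apply/funext => g; rewrite big_nil.
  rewrite (_ : (fun _ => _) = fun g => F i g + \sum_(j <- s) F j g); first exact: rfinD.
  by apply/funext => g; rewrite big_cons.
have -> : (fun g => sp_val (conj_act g f)) = fun g => \sum_j \sum_i
    (fun x => (c i (act (g^-1)%g (e j))) *: (c j x *: act g (sp_val f (e i)))).
  apply/funext => g; apply/funext => x; rewrite E1 fct_sumE.
  by apply: eq_bigr => j _; rewrite fct_sumE.
apply: (sumR) => j; apply: (sumR) => i; have [J [h [u [Rh huE]]]] := hE i.
exists J, (fun l g => c i (act (g^-1)%g (e j)) * h l g), (fun l x => c j x *: u l).
split=> [l|g]; first exact: regularM.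
apply/funext => x; rewrite fct_sumE huE !scaler_sumr.
by apply: eq_bigr => l _; rewrite fctE /= !scalerA -!mulrA [h l g * _]mulrC.
Qed.

Lemma homN_act_rational : rational homN_act.
Proof.
apply: rfin_rational.
- split=> [|a f g Rf Rg]; first exact: (regular_lin G).1.
  exact: (regular_lin G).2.
- move=> f X Rf; rewrite -[X]cosetK.
  rewrite /= (_ : (fun x => _) = fun x => f (coset N (x * repr X)%g)).
    exact: (@regularR _ _ (fun x => f (coset N x))).
  by apply/funext => x; rewrite -(to_quotM N x (repr X)).
- exact: homN_act1.
- exact: homN_actM.
move=> f.
have [n [h [p [Rh fp hE]]]] := rfin_orbit (regular_lin G) (conj_rfin f).
have hN i g m : N m -> h i (g * m)%g = h i g.
  move=> Nm; apply/eqP; rewrite -subr_eq0; apply/eqP; move: i; apply: fp.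
  under eq_bigr do rewrite scalerBl.
  rewrite sumrB -!hE conj_actM (conj_actN _ Nm).
  exact: subrr.
exists 'I_n, (fun i X => h i (repr X)), (fun i => conj_act (p i) f); split=> [i|X].
  rewrite /= (_ : (fun x => _) = h i) //; apply/funext => g.
  have /coset_eqP Ng := cosetK (coset N g).
  by rewrite -(hN _ _ _ Ng) mulVKg.
apply: val_inj; rewrite [LHS](hE (repr X)) raddf_sum.
by apply: eq_bigr => i _.
Qed.

(* Hom_N(E, V) with g N acting by f |-> g \o f \o g^-1. *)
Definition homN_module : rmodule (quot_group N) :=
  RModule homN_act_linear homN_act1 homN_actM homN_act_rational.

End HomModule.

Section RelativeExt.
Variables (k : closedFieldType) (A : fgroup k) (C : A -> Prop).

Definition direct_summand (X : rmodule A) (K : X -> Prop) : Prop :=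
  exists U : subspace X,
  [/\ forall c, C c -> forall u, U u -> U (act c u),
      forall x, K x -> U x -> x = 0 &
      forall x, exists y z, [/\ K y, U z & x = y + z]].

(* Where the next map is injective, or zero, its kernel is trivially a direct
   summand: the condition is only required at the inner terms of a sequence. *)
Definition rel_exact_at (X Y Z : rmodule A) (f : X -> Y) (g : Y -> Z) : Prop :=
  (forall y, g y = 0 <-> exists x, f x = y) /\
  direct_summand (fun y => g y = 0).

Definition rel_short_exact (M1 M2 M3 : rmodule A) (d1 : M1 -> M2) (d2 : M2 -> M3) : Prop :=
  [/\ hom M1 M2 d1, hom M2 M3 d2, injective d1, rel_exact_at d1 d2 &
      forall z, exists y, d2 y = z].

Definition rel_injective (I : rmodule A) : Prop :=
  forall (M1 M2 M3 : rmodule A) (d1 : M1 -> M2) (d2 : M2 -> M3),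
  rel_short_exact d1 d2 ->
  forall f, hom M1 I f -> exists2 h, hom M2 I h & f = h \o d1.

Record rel_resolution (X : rmodule A) := RelResolution {
  res_obj : nat -> rmodule A;
  res_aug : X -> res_obj 0;
  res_d : forall n, res_obj n -> res_obj n.+1;
  res_aug_hom : hom X (res_obj 0) res_aug;
  res_d_hom : forall n, hom (res_obj n) (res_obj n.+1) (@res_d n);
  res_aug_inj : injective res_aug;
  res_exact0 : rel_exact_at res_aug (@res_d 0);
  res_exactS : forall n, rel_exact_at (@res_d n) (@res_d n.+1);
  res_injective : forall n, rel_injective (res_obj n) }.

Section Ext.
Variables (X : rmodule A) (R : rel_resolution X) (Y : rmodule A).
Local Notation I := (res_obj R).
Local Notation d := (@res_d X R _).

Lemma hom_linear0 (U V : rmodule A) f : hom U V f -> f 0 = 0.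
Proof. by move=> [lf _]; have := lf (-1) 0 0; rewrite scaler0 addr0 scaleN1r addNr. Qed.

Lemma hom_comp (U V W : rmodule A) f g : hom U V f -> hom V W g -> hom U W (g \o f).
Proof.
move=> [lf ef] [lg eg]; split=> [a u v|c Cc x] /=; first by rewrite lf lg.
by rewrite ef ?eg.
Qed.

Lemma cocycle_subproof0 n : hom Y (I n) 0 /\ forall y, d ((0 : Y -> I n) y) = 0.
Proof. by split=> [|y]; [exact: sp0|exact: (hom_linear0 (res_d_hom R n))]. Qed.

Lemma cocycle_subproofP n a (f g : Y -> I n) :
  hom Y (I n) f /\ (forall y, d (f y) = 0) ->
  hom Y (I n) g /\ (forall y, d (g y) = 0) ->
  hom Y (I n) (a *: f + g) /\ forall y, d ((a *: f + g) y) = 0.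
Proof.
move=> [hf df] [hg dg]; split=> [|y]; first exact: (@spP _ _ (hom Y (I n))) hf hg.
have [ld _] := res_d_hom R n.
by rewrite [LHS](ld a (f y) (g y)) df dg scaler0 addr0.
Qed.

Definition cocycles n : subspace (Y -> I n) :=
  @Subspace k (Y -> I n : lmodType k)
    (fun f => hom Y (I n) f /\ forall y, d (f y) = 0)
    (@cocycle_subproof0 n) (@cocycle_subproofP n).

Definition is_coboundary n : (Y -> I n) -> Prop :=
  match n with
  | 0 => fun f => f = 0
  | m.+1 => fun f => exists2 g, hom Y (I m) g & f = @res_d X R m \o g
  end.

Lemma coboundary_subproof0 n : @is_coboundary n 0.
Proof.
case: n => [//|n]; exists 0; first exact: sp0.
by apply/funext => y; rewrite /= (hom_linear0 (res_d_hom R n)).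
Qed.

Lemma coboundary_subproofP n a (f g : Y -> I n) :
  is_coboundary f -> is_coboundary g -> is_coboundary (a *: f + g).
Proof.
case: n f g => [|n] f g /=; first by move=> -> ->; rewrite scaler0 addr0.
move=> [f' hf ->] [g' hg ->]; exists (a *: f' + g'); first exact: (@spP _ _ (hom Y (I n))) hf hg.
have [ld _] := res_d_hom R n.
by apply/funext => y; rewrite [RHS](ld a (f' y) (g' y)).
Qed.

Definition coboundaries n : subspace (Y -> I n) :=
  @Subspace k (Y -> I n : lmodType k) (@is_coboundary n)
    (@coboundary_subproof0 n) (@coboundary_subproofP n).

(* Ext^n_{(A,C)}(Y, X), computed from the resolution R of X. *)
Definition relExt n : lmodType k := subquot (cocycles n) (coboundaries n).

End Ext.
End RelativeExt.

Arguments relExt {k A C X} R Y n.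

(* Main.v *)
(* For a G/N-module M and a G-module V, Hom_{G/N}(M, Hom_N(E, V)) is
   Hom_G(M (x) E, V).  Both functors are additive, so they preserve contractions:
   M |-> M (x) E maps (G/N, H/N)-exact short sequences to (G, H)-exact ones, hence
   Hom_N(E, -) preserves relative injectives; and since N <= H, a contraction
   over H induces one on Hom_N(E, -).  Thus Hom_N(E, -) maps a (G, H)-injective
   resolution of V to a (G/N, H/N)-injective resolution of Hom_N(E, V), and the
   adjunction identifies the two complexes.  The comparison theorem then replaces
   this resolution by an arbitrary one. *)
Require Import Defs.
From HB Require Import structures.
From mathcomp Require Import all_boot all_order all_algebra.
From mathcomp Require Import boolp functions monoid.

(* Takes [hom] back from mathcomp's [vector]. *)
Import Defs.

Set Implicit Arguments.
Unset Strict Implicit.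
Unset Printing Implicit Defensive.

Import GRing.Theory.
Local Open Scope ring_scope.

(** * Linear maps as plain functions, and isomorphisms of subquotients *)

Section LinearFunctions.
Variables (k : fieldType) (U V : lmodType k) (f : U -> V).
Hypothesis lf : linear f.

Lemma linfun0 : f 0 = 0.
Proof. by have := lf (-1) 0 0; rewrite scaler0 addr0 scaleN1r addNr. Qed.

Lemma linfunD u v : f (u + v) = f u + f v.
Proof. by have := lf 1 u v; rewrite !scale1r. Qed.

Lemma linfunB u v : f (u - v) = f u - f v.
Proof. by rewrite addrC -scaleN1r lf scaleN1r addrC. Qed.

Lemma linfun_eq u v : f (u - v) = 0 -> f u = f v.
Proof. by rewrite linfunB => /eqP; rewrite subr_eq0 => /eqP. Qed.

End LinearFunctions.

(** The equivalence between [B] and [B'] makes the map induced on classes both well defined and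
    injective; the last hypothesis makes it surjective. *)
Lemma subquot_iso (k : fieldType) (V V' : lmodType k) (Z B : subspace V)
    (Z' B' : subspace V') (f : V -> V') :
  (forall a u v, Z u -> Z v -> f (a *: u + v) = a *: f u + f v) ->
  (forall z, Z z -> Z' (f z)) ->
  (forall z, Z z -> B z <-> B' (f z)) ->
  (forall z', Z' z' -> exists2 z, Z z & B' (f z - z')) ->
  lmod_iso (subquot Z B) (subquot Z' B').
Proof.
move=> lf ZZ BB sf.
have fB z1 z2 : Z z1 -> Z z2 -> f (z1 - z2) = f z1 - f z2.
  by move=> Z1 Z2; rewrite addrC -scaleN1r lf // scaleN1r addrC.
pose F (x : subquot Z B) : subquot Z' B' :=
  qclass _ (in_sp (ZZ _ (sp_valP (repr x)))).
have FE (z : sp_sort Z) : F (qclass _ z) = qclass _ (in_sp (ZZ _ (sp_valP z))).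
  apply/qclass_eqP => /=; rewrite -fB; [|exact: sp_valP|exact: sp_valP].
  apply/BB; first by apply: spB; exact: sp_valP.
  by have /qclass_eqP := qclassK (qclass _ z : subquot Z B).
have linF : linear F.
  move=> a x y; rewrite -[x]qclassK -[y]qclassK -qclassZ -qclassD !FE.
  rewrite -qclassZ -qclassD; congr (qclass _ _); apply: val_inj => /=.
  by rewrite lf //; exact: sp_valP.
have injF : injective F.
  move=> x y; rewrite -[x]qclassK -[y]qclassK !FE => /qclass_eqP /= H.
  apply/qclass_eqP => /=; apply/BB; first by apply: spB; exact: sp_valP.
  by rewrite fB //; exact: sp_valP.
have surF y : exists x, F x = y.
  have [z Zz Bz] := sf _ (sp_valP (repr y)).
  by exists (qclass _ (in_sp Zz)); rewrite FE -[RHS]qclassK; apply/qclass_eqP.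
have [G GK] := choice surF.
pose Fl : {linear subquot Z B -> subquot Z' B'} :=
  HB.pack F (GRing.isLinear.Build k _ _ _ F linF).
by exists Fl; exists G => // x; apply: injF; rewrite GK.
Qed.

Lemma lmod_iso_trans (k : fieldType) (U V W : lmodType k) :
  lmod_iso U V -> lmod_iso V W -> lmod_iso U W.
Proof.
move=> [f bf] [g bg]; exists (g \o f : {linear U -> W}); exact: bij_comp.
Qed.

(** * Relatively exact sequences and contractions *)

Section RelativeExactness.
Variables (k : closedFieldType) (A : fgroup k) (C : A -> Prop).

Lemma hom_hom_over (X Y : rmodule A) f : hom X Y f -> hom_over C X Y f.
Proof. by move=> [lf ef]; split=> // c _; apply: ef. Qed.

Lemma hom_over_comp (X Y Z : rmodule A) f g :
  hom_over C X Y f -> hom_over C Y Z g -> hom_over C X Z (g \o f).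
Proof.
move=> [lf ef] [lg eg]; split=> [a u v|c Cc x] /=; first by rewrite lf lg.
by rewrite ef ?eg.
Qed.

Lemma hom_over_id (X : rmodule A) : hom_over C X X id.
Proof. by []. Qed.

Lemma hom_id (X : rmodule A) : hom X X id.
Proof. by []. Qed.

Lemma hom_overB (X Y : rmodule A) f g :
  hom_over C X Y f -> hom_over C X Y g -> hom_over C X Y (fun x => f x - g x).
Proof. exact: spB. Qed.

Lemma homB (X Y : rmodule A) f g :
  hom X Y f -> hom X Y g -> hom X Y (fun x => f x - g x).
Proof. exact: spB. Qed.

Lemma direct_summand_ker (X Y Z : rmodule A) (f : X -> Y) (g : X -> Z) :
  (forall x, f x = 0 <-> g x = 0) ->
  direct_summand C (fun x => f x = 0) -> direct_summand C (fun x => g x = 0).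
Proof.
move=> fg [U [UC U0 UD]]; exists U; split=> // [x /fg|x]; first exact: U0.
by have [y [z [/fg ? ? ->]]] := UD x; exists y, z.
Qed.

Lemma direct_summand_inj (X Y : rmodule A) (f : X -> Y) :
  linear f -> injective f -> direct_summand C (fun x => f x = 0).
Proof.
move=> lf injf; exists (Subspace (sp_set := fun=> True) I (fun _ _ _ _ _ => I)).
split=> // [x fx _|x]; first by apply: injf; rewrite fx linfun0.
by exists 0, x; rewrite linfun0 // add0r.
Qed.

(** With [U] a complement of Ker f and [W] one of Ker g = Im f, each [y] has exactly one [x] in [U]
    with [y - f x] in [W]. Uniqueness and the stability of [U] and [W] make this choice linear and
    [C]-equivariant. *)
Lemma split_inverse (X Y Z : rmodule A) (f : X -> Y) (g : Y -> Z) :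
  hom X Y f -> direct_summand C (fun x => f x = 0) -> rel_exact_at C f g ->
  exists2 s, hom_over C Y X s & forall y, g y = 0 -> f (s y) = y.
Proof.
move=> [lf ef] [U [UC U0 UD]] [gf [W [WC W0 WD]]].
pose P y x := U x /\ W (y - f x).
have exP y : exists x, P y x.
  have [_ [w [/gf [x <-] Ww ->]]] := WD y; have [x0 [u [fx0 Uu ->]]] := UD x.
  by exists u; split=> //; rewrite (linfunD lf) fx0 add0r addrC addKr.
have uP y x x' : P y x -> P y x' -> x = x'.
  move=> [Ux Wx] [Ux' Wx']; apply/eqP; rewrite -subr_eq0; apply/eqP.
  apply: U0; last exact: spB.
  apply: W0; first by apply/gf; exists (x - x').
  have -> : f (x - x') = (y - f x') - (y - f x).
    by rewrite (linfunB lf) opprB [RHS]addrC addrA subrK.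
  exact: spB.
have [s sP] := choice exP; exists s; first split.
- move=> a u v; apply: uP (sP _) _; have [Uu Wu] := sP u; have [Uv Wv] := sP v.
  split; first exact: spP.
  have -> : a *: u + v - f (a *: s u + s v) = a *: (u - f (s u)) + (v - f (s v)).
    by rewrite lf scalerBr opprD addrACA.
  exact: spP.
- move=> c Cc x; apply: uP (sP _) _; have [Ux Wx] := sP x.
  split; first exact: UC.
  by rewrite ef // -(linfunB (act_linear c)); apply: WC.
move=> y /gf [x xy]; have [_ Wy] := sP y.
apply/esym/eqP; rewrite -subr_eq0; apply/eqP; apply: W0 Wy.
by apply/gf; exists (x - s y); rewrite (linfunB lf) // xy.
Qed.

(* f s + t g = 1 is a contraction at Y; unlike direct summands it is preserved
   by every additive functor. *)
Lemma rel_exact_contraction (X Y Z T : rmodule A) (f : X -> Y) (g : Y -> Z)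
    (h : Z -> T) :
  hom X Y f -> hom Y Z g -> direct_summand C (fun x => f x = 0) ->
  rel_exact_at C f g -> rel_exact_at C g h ->
  exists s t, [/\ hom_over C Y X s, hom_over C Z Y t &
    forall y, f (s y) + t (g y) = y].
Proof.
move=> hf hg sf fg gh; have [s hs sE] := split_inverse hf sf fg.
have [t ht tE] := split_inverse hg fg.2 gh.
have [lg _] := hg.
(* [y - t (g y)] is the component of [y] in Ker g, where [f \o s] is the identity. *)
exists (s \o (fun y => y - t (g y))), t; split=> //.
  apply: hom_over_comp hs; apply: hom_overB (hom_over_id _) _.
  exact: hom_over_comp (hom_hom_over hg) ht.
move=> y /=; rewrite sE ?subrK // (linfunB lg) // tE ?subrr //.
by apply/gh.1; exists y.
Qed.

(** A contraction gives [g t g = g], so [t \o g] is idempotent; its fixed vectors form a [C]-stable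
    complement of Ker g. *)
Lemma contraction_rel_exact (X Y Z : rmodule A) (f : X -> Y) (g : Y -> Z)
    (s : Y -> X) (t : Z -> Y) :
  hom Y Z g -> hom_over C Z Y t -> (forall x, g (f x) = 0) ->
  (forall y, f (s y) + t (g y) = y) -> rel_exact_at C f g.
Proof.
move=> hg ht gf st; have [lg eg] := hg; have [lt et] := ht.
split=> [y|].
  split=> [gy|[x <-]//]; exists (s y).
  by rewrite -[RHS]st gy linfun0 // addr0.
have gtg y : g (t (g y)) = g y by rewrite -[in RHS](st y) (linfunD lg) gf add0r.
have U0 : t (g 0) = 0 by rewrite !linfun0.
have UP a u v : t (g u) = u -> t (g v) = v -> t (g (a *: u + v)) = a *: u + v.
  by move=> hu hv; rewrite lg lt hu hv.
exists (Subspace (sp_set := fun y => t (g y) = y) U0 UP); split=> /=.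
- by move=> c Cc u tu; rewrite eg // et // tu.
- by move=> x gx <-; rewrite gx linfun0.
- by move=> y; exists (f (s y)), (t (g y)); rewrite gf gtg st.
Qed.

(** Cancelling the injective [f] and the surjective [g] in the contraction identity turns [s] into a
    retraction and [t] into a section. *)
Lemma rel_short_exact_contraction (X Y Z : rmodule A) (f : X -> Y) (g : Y -> Z) :
  rel_short_exact C f g ->
  exists s t, [/\ hom_over C Y X s, hom_over C Z Y t,
    forall x, s (f x) = x, forall z, g (t z) = z &
    forall y, f (s y) + t (g y) = y].
Proof.
move=> [hf hg injf fg sg]; have [lf _] := hf; have [lg _] := hg.
(* The zero map continues the sequence, as [g] is surjective; its kernel is all of [Z], with
   complement 0. *)
have gh : rel_exact_at C g (0 : Z -> Z).
  split=> [z|]; first by split=> // _; exact: sg.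
  exists (Subspace (sp_set := fun z : Z => z = 0) erefl
           (fun a u v u0 v0 => etrans (congr2 (fun u v => a *: u + v) u0 v0)
              (etrans (addr0 _) (scaler0 _ a)))).
  split=> /= [c _ _ ->|//|z]; first exact: act_0.
  by exists z, 0; rewrite addr0.
have [s [t [hs ht st]]] :=
  rel_exact_contraction hf hg (direct_summand_inj lf injf) fg gh.
exists s, t; split=> // [x|z].
  apply: injf; rewrite -[RHS]st.
  have -> : g (f x) = 0 by apply/fg.1; exists x.
  by rewrite (linfun0 ht.1) addr0.
have [y <-] := sg z; rewrite -[in RHS](st y) (linfunD lg).
by have -> : g (f (s y)) = 0; [apply/fg.1; exists (s y)|rewrite add0r].
Qed.

End RelativeExactness.

(** * The comparison theorem for relatively injective resolutions *)

Section Comparison.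
Variables (k : closedFieldType) (A : fgroup k) (C : A -> Prop).
(** The group to come is [G/N], given only as an [fgroup]: these two properties of its regular
    functions yield the rationality of submodules. *)
Hypothesis regular_lin : lin_closed (@regular k A).
Hypothesis regular_translate :
  forall f h, regular f -> regular (fun g : A => f (g * h)%g).

Section Submodule.
Variables (X : rmodule A) (W : subspace X).
Hypothesis W_stable : forall g x, W x -> W (act g x).

Definition sub_act (g : A) (x : sp_sort W) : sp_sort W :=
  in_sp (W_stable g (sp_valP x)).

Lemma sub_act_linear g : linear (sub_act g).
Proof. by move=> a x y; apply: val_inj; rewrite /= act_linear. Qed.

Lemma sub_act1 x : sub_act 1%g x = x.
Proof. by apply: val_inj; rewrite /= act1. Qed.

Lemma sub_actM g h x : sub_act (g * h)%g x = sub_act g (sub_act h x).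
Proof. by apply: val_inj; rewrite /= actM. Qed.

(** [rfin_orbit] expands [g x] in finitely many translates of [x] with regular coefficients, and
    these translates already lie in [W]. *)
Lemma sub_act_rational : rational sub_act.
Proof.
apply: rfin_rational => // [||x]; [exact: sub_act1|exact: sub_actM|].
have [n [h [p [Rh _ hE]]]] := rfin_orbit regular_lin
  (rational_rfin regular_lin (@act_linear _ _ X) (@act_rational _ _ X) (sp_val x)).
exists 'I_n, h, (fun i => sub_act (p i) x); split=> // g.
by apply: val_inj; rewrite raddf_sum; exact: hE.
Qed.

Definition submodule : rmodule A :=
  RModule sub_act_linear sub_act1 sub_actM sub_act_rational.

End Submodule.

Section KerIm.
Variables (X Y : rmodule A) (f : X -> Y).
Hypothesis hf : hom X Y f.

Lemma ker_subproofP a u v : f u = 0 -> f v = 0 -> f (a *: u + v) = 0.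
Proof. by move=> fu fv; rewrite hf.1 fu fv scaler0 addr0. Qed.
Definition ker_sp : subspace X :=
  Subspace (sp_set := fun x => f x = 0) (linfun0 hf.1) ker_subproofP.

Lemma im_subproof0 : exists x, f x = 0.
Proof. by exists 0; apply: linfun0 hf.1. Qed.
Lemma im_subproofP a u v :
  (exists x, f x = u) -> (exists x, f x = v) -> exists x, f x = a *: u + v.
Proof. by move=> [x <-] [y <-]; exists (a *: x + y); apply: hf.1. Qed.
Definition im_sp : subspace Y :=
  Subspace (sp_set := fun y => exists x, f x = y) im_subproof0 im_subproofP.

Lemma ker_stable g x : ker_sp x -> ker_sp (act g x).
Proof. by move=> fx; rewrite /= hf.2 // fx act_0. Qed.

Lemma im_stable g y : im_sp y -> im_sp (act g y).
Proof. by move=> [x <-]; exists (act g x); rewrite hf.2. Qed.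

End KerIm.

(* Injectivity is applied to 0 -> Ker c -> Y -> Im c -> 0, where Ker c = Im b. *)
Lemma rel_injective_extend (X Y Z J : rmodule A) (b : X -> Y) (c : Y -> Z)
    (f : X -> J) :
  rel_injective C J -> hom X Y b -> hom Y Z c -> rel_exact_at C b c ->
  hom X J f -> (forall x, b x = 0 -> f x = 0) ->
  exists2 h, hom Y J h & forall x, h (b x) = f x.
Proof.
move=> Jinj hb hc [bc sc] hf bf.
pose K := submodule (ker_stable (hf := hc)).
pose I := submodule (im_stable (hf := hc)).
(* [c] is corestricted to its image so as to become surjective. *)
pose c' (y : Y) : I := in_sp (W := im_sp hc) (ex_intro _ y erefl).
have hc' : hom Y I c'.
  by split=> [a u v|g _ x]; apply: val_inj; rewrite /= ?hc.1 ?hc.2.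
have cc' y : c y = 0 <-> c' y = 0.
  split=> [cy|/(congr1 val) //]; exact: val_inj.
have ex : rel_short_exact C (@sp_val _ _ (ker_sp hc) : K -> Y) c'.
  split=> //; first exact: val_inj.
    split; last exact: direct_summand_ker cc' sc.
    move=> y; split=> [/cc' cy|[x <-]]; last exact/cc'/(sp_valP x).
    by exists (in_sp (W := ker_sp hc) cy).
  by move=> z; have [y yz] := sp_valP z; exists y; apply: val_inj.
(* [p] picks preimages under [b]. Since [f] kills Ker b, [f \o p] is independent of the choice,
   hence a homomorphism. *)
have [p pE] := choice (fun z : K => (bc (sp_val z)).1 (sp_valP z)).
have fp z x : b x = sp_val z -> f (p z) = f x.
  move=> bx; apply: (linfun_eq hf.1); apply: bf.
  by rewrite (linfunB hb.1) pE bx subrr.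
have hfp : hom K J (f \o p).
  split=> [a u v|g _ x] /=.
    by rewrite -hf.1; apply: fp; rewrite hb.1 !pE.
  by rewrite -hf.2 //; apply: fp; rewrite hb.2 // pE.
have [h hh hE] := Jinj _ _ _ _ _ ex _ hfp; exists h => // x.
have cbx : ker_sp hc (b x) by apply/bc; exists x.
by have /= := congr1 (@^~ (in_sp cbx)) hE; rewrite (fp _ x) // => ->.
Qed.

Section Lifts.
Variables (X X' : rmodule A).
Variables (R : rel_resolution C X) (R' : rel_resolution C X').

(* phi is the n-th component of a chain map R -> R' over u : X -> X', defined
   in degrees <= n. *)
Fixpoint lifts (u : X -> X') n : (res_obj R n -> res_obj R' n) -> Prop :=
  match n with
  | 0 => fun phi => hom (res_obj R 0) (res_obj R' 0) phi /\
      forall x, phi (res_aug R x) = res_aug R' (u x)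
  | m.+1 => fun phi => hom (res_obj R m.+1) (res_obj R' m.+1) phi /\
      exists2 psi, lifts u (n := m) psi &
        forall x, phi (@res_d _ _ _ _ R m x) = @res_d _ _ _ _ R' m (psi x)
  end.

Lemma lifts_hom u n phi : lifts u (n := n) phi ->
  hom (res_obj R n) (res_obj R' n) phi.
Proof. by case: n phi => [|n] phi []. Qed.

Lemma res_dd n x : @res_d _ _ _ _ R n.+1 (@res_d _ _ _ _ R n x) = 0.
Proof. by apply/(res_exactS R n).1; exists x. Qed.

Lemma res_d_aug x : @res_d _ _ _ _ R 0 (res_aug R x) = 0.
Proof. by apply/(res_exact0 R).1; exists x. Qed.

End Lifts.

Arguments lifts {X X'} R R' u n phi.

(** By exactness a cocycle comes from the preceding term of [R], and [phi] carries it to an element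
    coming from the preceding term of [R']. *)
Lemma lifts_cocycles (X X' : rmodule A) (R : rel_resolution C X)
    (R' : rel_resolution C X') u n phi : lifts R R' u n phi ->
  forall x, @res_d _ _ _ _ R n x = 0 -> @res_d _ _ _ _ R' n (phi x) = 0.
Proof.
case: n phi => [|n] phi /=.
  by move=> [_ E] x /(res_exact0 R).1 [y <-]; rewrite E res_d_aug.
move=> [_ [psi _ E]] x /(res_exactS R n).1 [y <-].
by rewrite E res_dd.
Qed.

(** The chain map is built degree by degree: [lifts_cocycles] gives the vanishing on Ker d that
    allows the next extension along [d]. *)
Lemma lifts_exist (X X' : rmodule A) (R : rel_resolution C X)
    (R' : rel_resolution C X') u n : hom X X' u ->
  exists phi, lifts R R' u n phi.
Proof.
move=> hu; elim: n => [|n [phi Lphi]].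
  have [|h hh hE] := rel_injective_extend (f := res_aug R' \o u)
    (@res_injective _ _ _ _ R' 0) (res_aug_hom R) (res_d_hom R 0) (res_exact0 R)
    (hom_comp hu (res_aug_hom R')) _; last by exists h.
  move=> x /= aug0; have -> : x = 0.
    by apply: (res_aug_inj (r := R)); rewrite aug0 (linfun0 (res_aug_hom R).1).
  by rewrite (linfun0 hu.1) (linfun0 (res_aug_hom R').1).
have [h hh hE] := rel_injective_extend (f := @res_d _ _ _ _ R' n \o phi)
  (@res_injective _ _ _ _ R' n.+1) (res_d_hom R n) (res_d_hom R n.+1) (res_exactS R n)
  (hom_comp (lifts_hom Lphi) (res_d_hom R' n)) (lifts_cocycles Lphi).
by exists h; split=> //; exists phi.
Qed.

Lemma lifts_comp (X X' X'' : rmodule A) (R : rel_resolution C X)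
    (R' : rel_resolution C X') (R'' : rel_resolution C X'') u v n phi psi :
  lifts R R' u n phi -> lifts R' R'' v n psi ->
  lifts R R'' (v \o u) n (psi \o phi).
Proof.
elim: n phi psi => [|n IH] phi psi /= [hphi Ephi] [hpsi Epsi].
  by split=> [|x]; [exact: hom_comp hphi hpsi|rewrite /= Ephi Epsi].
split; first exact: hom_comp hphi hpsi.
have [phi' Lphi E1] := Ephi; have [psi' Lpsi E2] := Epsi.
by exists (psi' \o phi'); [exact: IH|move=> x /=; rewrite E1 E2].
Qed.

Lemma lifts_id (X : rmodule A) (R : rel_resolution C X) n :
  lifts R R id n id.
Proof. by elim: n => [|n IH] /=; split=> //; exists id. Qed.

Lemma liftsB (X X' : rmodule A) (R : rel_resolution C X)
    (R' : rel_resolution C X') u v n phi psi :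
  lifts R R' u n phi -> lifts R R' v n psi ->
  lifts R R' (fun x => u x - v x) n (fun x => phi x - psi x).
Proof.
elim: n phi psi => [|n IH] phi psi /= [hphi Ephi] [hpsi Epsi].
  by split=> [|x]; [exact: homB|rewrite Ephi Epsi (linfunB (res_aug_hom R').1)].
split; first exact: homB.
have [phi' Lphi E1] := Ephi; have [psi' Lpsi E2] := Epsi.
exists (fun x => phi' x - psi' x); first exact: IH.
by move=> x /=; rewrite E1 E2 (linfunB (res_d_hom R' n).1).
Qed.

Lemma coboundaries_cocycles (X Y : rmodule A) (R : rel_resolution C X) n f :
  coboundaries R Y n f -> cocycles R Y n f.
Proof.
case: n f => [|n] f /=; first by move=> ->; exact: (sp0 (cocycles R Y 0)).
move=> [s hs ->]; split=> [|x]; first exact: hom_comp hs (res_d_hom R n).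
by rewrite /= res_dd.
Qed.

(* A chain map over 0 is null homotopic; only the restriction of the homotopy to
   the cocycles is recorded. *)
Lemma lifts0_coboundary (X X' : rmodule A) (R : rel_resolution C X)
    (R' : rel_resolution C X') u n phi :
  (forall x, u x = 0) -> lifts R R' u n phi ->
  exists2 psi, coboundaries R' (res_obj R n) n psi &
    forall x, @res_d _ _ _ _ R n x = 0 -> phi x = psi x.
Proof.
move=> u0; elim: n phi => [|n IH] phi /= [hphi Ephi].
  (* In degree 0 the cocycles come from the augmentation, where [phi] is induced by [u = 0]. *)
  exists 0 => // x /(res_exact0 R).1 [y <-].
  by rewrite Ephi u0 (linfun0 (res_aug_hom R').1).
have [phi' Lphi E] := Ephi; have [psi cpsi psiE] := IH _ Lphi.
have [hpsi dpsi] := coboundaries_cocycles cpsi.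
(* [phi' - psi] vanishes on Ker d, so it extends along [d] to a map [s], the next component of the
   homotopy. As [psi] takes values in cocycles, [phi] and [d \o s] agree on Im d. *)
have [||s hs sE] := rel_injective_extend (f := fun x => phi' x - psi x)
  (@res_injective _ _ _ _ R' n) (res_d_hom R n) (res_d_hom R n.+1) (res_exactS R n).
- exact: homB (lifts_hom Lphi) hpsi.
- by move=> x dx; rewrite psiE // subrr.
exists (@res_d _ _ _ _ R' n \o s); first by exists s.
move=> x /(res_exactS R n).1 [y <-] /=.
by rewrite E sE (linfunB (res_d_hom R' n).1) dpsi subr0.
Qed.

Lemma coboundaries_precomp (X Y Z : rmodule A) (R : rel_resolution C X) n
    (f : Y -> Z) g : hom Y Z f ->
  coboundaries R Z n g ->
  coboundaries R Y n (g \o f).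
Proof.
case: n g => [|n] g hf /=; first by move=> ->.
by move=> [s hs ->]; exists (s \o f) => //; exact: hom_comp hf hs.
Qed.

Lemma coboundaries_lifts (X X' Y : rmodule A) (R : rel_resolution C X)
    (R' : rel_resolution C X') u n phi f : lifts R R' u n phi ->
  coboundaries R Y n f ->
  coboundaries R' Y n (phi \o f).
Proof.
case: n phi f => [|n] phi f /= [hphi Ephi].
  by move=> ->; apply/funext => y; exact: linfun0 hphi.1.
move=> [s hs ->]; have [psi Lpsi E] := Ephi.
exists (psi \o s); first exact: hom_comp hs (lifts_hom Lpsi).
by apply/funext => y; rewrite /= E.
Qed.

(** [phi - psi] lifts [u - u = 0], so on cocycles it agrees with a coboundary, which is then
    precomposed with [f]. *)
Lemma lifts_homotopic (X X' Y : rmodule A) (R : rel_resolution C X)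
    (R' : rel_resolution C X') u n phi psi f :
  lifts R R' u n phi -> lifts R R' u n psi -> cocycles R Y n f ->
  coboundaries R' Y n (fun y => phi (f y) - psi (f y)).
Proof.
move=> Lphi Lpsi [hf df].
have [chi cchi E] := lifts0_coboundary (fun x => subrr (u x)) (liftsB Lphi Lpsi).
suff -> : (fun y => phi (f y) - psi (f y)) = chi \o f.
  exact: coboundaries_precomp hf cchi.
by apply/funext => y; rewrite /= -E.
Qed.

(** Lifts of the identity in both directions compose to lifts of the identity, which act on
    cohomology as the identity. *)
Lemma relExt_resolution_independent (X Y : rmodule A) (R R' : rel_resolution C X) n :
  lmod_iso (relExt R Y n) (relExt R' Y n).
Proof.
have [phi Lphi] := lifts_exist R R' n (@hom_id k A X).
have [psi Lpsi] := lifts_exist R' R n (@hom_id k A X).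
have cocyc (P P' : rel_resolution C X) chi (f : Y -> res_obj P n) :
    lifts P P' id n chi -> cocycles P Y n f -> cocycles P' Y n (chi \o f).
  move=> Lchi [hf df]; split; first exact: hom_comp hf (lifts_hom Lchi).
  by move=> y; apply: (lifts_cocycles Lchi).
apply: (@subquot_iso _ _ _ _ _ _ _ (fun f : Y -> res_obj R n => phi \o f)).
- move=> a f g _ _; apply/funext => y; exact: (lifts_hom Lphi).1.
- by move=> f; apply: cocyc.
- move=> f cf; split; first exact: coboundaries_lifts Lphi.
  move=> /(coboundaries_lifts Lpsi) cb.
  have h := lifts_homotopic (lifts_comp Lphi Lpsi) (lifts_id R n) cf.
  (* Both terms of this difference are coboundaries: the first by assumption on [phi \o f], the
     second by homotopy. *)
  have -> : f = (psi \o (phi \o f)) - (fun y => psi (phi (f y)) - f y).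
    by apply/funext => y; rewrite !fctE subKr.
  by apply: (spB (W := coboundaries R Y n)).
move=> f cf; exists (psi \o f); first exact: cocyc Lpsi cf.
exact: lifts_homotopic (lifts_comp Lpsi Lphi) (lifts_id R' n) cf.
Qed.

End Comparison.

(** * Functoriality of the tensor product with [E], and relative exactness *)

Lemma tens_ext (k : fieldType) (M E U : lmodType k) (f g : tens M E -> U) :
  linear f -> linear g -> (forall m e, f (pure m e) = g (pure m e)) ->
  forall t, f t = g t.
Proof.
move=> lf lg fg t; apply/eqP; rewrite -subr_eq0; apply/eqP.
have W0 : f 0 - g 0 = 0 by rewrite (linfun0 lf) (linfun0 lg) subrr.
have WP a u v : f u - g u = 0 -> f v - g v = 0 ->
    f (a *: u + v) - g (a *: u + v) = 0.
  move=> fu fv; rewrite lf lg opprD addrACA -scalerBr fu fv scaler0; exact: addr0.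
apply: (pure_ind (W := Subspace W0 WP)) => m e /=.
by rewrite fg subrr.
Qed.

Section TensorMap.
Variables (k : fieldType) (M M' E : lmodType k) (f : M -> M').
Hypothesis lf : linear f.

Definition tens_map : tens M E -> tens M' E :=
  tens_lift (fun m e => pure (f m) e).

Let linl e : linear (fun m => pure (f m) e : tens M' E).
Proof. by move=> a u v; rewrite lf pure_linearl. Qed.
Let linr m : linear (fun e => pure (f m) e : tens M' E).
Proof. exact: pure_linearr. Qed.

Lemma tens_map_pure m e : tens_map (pure m e) = pure (f m) e.
Proof. exact: tens_lift_pure. Qed.

Lemma tens_map_linear : linear tens_map.
Proof. exact: tens_lift_linear. Qed.

End TensorMap.

Section Functors.
Variables (k : closedFieldType) (G : algGroup k) (N : normal_subgroup G).
Variables (H : closed_subgroup G) (NH : forall g : G, N g -> H g).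
Variables (E : rmodule G) (finE : finite_dim E).

Local Notation Q := (quot_group N).
Local Notation QH := (quot_subgroup N H).
Local Notation L := (fun M : rmodule Q => tensor (inflate M) E).
Local Notation F := (fun V : rmodule G => homN_module N V finE).

Lemma quot_regular_lin : lin_closed (@regular k Q).
Proof.
split=> [|a f g Rf Rg]; first exact: (regular_lin G).1.
exact: (regular_lin G).2.
Qed.

Lemma quot_regular_translate f h :
  regular f -> regular (fun g : Q => f (g * h)%g).
Proof.
move=> Rf; rewrite -[h]cosetK.
rewrite /= (_ : (fun x => _) = fun x => f (coset N (x * repr h)%g)).
  exact: (@regularR _ _ (fun x => f (coset N x))).
by apply/funext => x; rewrite -(to_quotM N x (repr h)).
Qed.

Lemma to_quotP (X : Q) : exists g, X = to_quot N g.
Proof. by exists (repr X); rewrite -[LHS]cosetK. Qed.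

Lemma to_quotN g : N g -> to_quot N g = 1%g.
Proof.
move=> Ng; rewrite -to_quot1; apply/esym/coset_eqP.
by rewrite invg1 mul1g.
Qed.

Lemma homN_module_actE (V : rmodule G) g (f : F V) e :
  sp_val (act (to_quot N g) f) e = act g (sp_val f (act (g^-1)%g e)).
Proof. exact: (congr1 (fun u => sp_val u e) (homN_actE g f)). Qed.

(** [C] and [CQ] vary so as to cover both homomorphisms over the full groups and contractions over
    [H] and [H/N]. *)
Lemma tens_map_hom_over (C : G -> Prop) (CQ : Q -> Prop) (M M' : rmodule Q) f :
  (forall g, C g -> CQ (to_quot N g)) ->
  hom_over CQ M M' f -> hom_over C (L M) (L M') (tens_map f).
Proof.
move=> CCQ [lf ef]; split=> [|g Cg]; first exact: tens_map_linear.
apply: tens_ext => [a u v|a u v|m e].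
- rewrite [act g _](act_linear (r := L M)); exact: tens_map_linear.
- rewrite (tens_map_linear lf); exact: (act_linear (r := L M')).
rewrite /= tens_map_pure // !tens_act_pure tens_map_pure //=.
by rewrite ef //; apply: CCQ.
Qed.

Lemma tens_map_comp (M M' M'' : lmodType k) (f : M -> M') (g : M' -> M'') :
  linear f -> linear g ->
  forall t : tens M E, tens_map g (tens_map f t) = tens_map (g \o f) t.
Proof.
move=> lf lg; have lgf : linear (g \o f) by move=> a u v /=; rewrite lf lg.
apply: tens_ext => [a u v||m e]; last by rewrite !tens_map_pure.
  by rewrite !tens_map_linear.
exact: tens_map_linear.
Qed.

Lemma tens_mapK (M M' : lmodType k) (f : M -> M') (g : M' -> M) :
  linear f -> linear g -> cancel f g -> cancel (@tens_map k M M' E f) (tens_map g).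
Proof.
move=> lf lg fK t; rewrite tens_map_comp //.
have lgf : linear (g \o f) by move=> a u v /=; rewrite lf lg.
apply: (tens_ext (g := id)) t => // [|m e]; first exact: tens_map_linear.
by rewrite tens_map_pure //= fK.
Qed.

(** The contraction is tensored with [E]. Its identities, checked on pure tensors, give injectivity,
    exactness, splitting and surjectivity. *)
Lemma tensor_rel_short_exact (M1 M2 M3 : rmodule Q) (f : M1 -> M2) (g : M2 -> M3) :
  rel_short_exact QH f g ->
  rel_short_exact (M1 := L M1) (M2 := L M2) (M3 := L M3) H (tens_map f) (tens_map g).
Proof.
move=> fg; have [s [t [hs ht sf gt st]]] := rel_short_exact_contraction fg.
have [hf hg _ [gf0 _] _] := fg; have [lf lg ls lt] := And4 hf.1 hg.1 hs.1 ht.1.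
have HQ h : H h -> QH (to_quot N h) by exists h.
have hom_map (M M' : rmodule Q) p (hp : hom M M' p) : hom (L M) (L M') (tens_map p).
  exact: tens_map_hom_over hp.
split; [exact: hom_map|exact: hom_map| | |].
- exact: can_inj (tens_mapK lf ls sf).
- apply: (@contraction_rel_exact _ _ _ (L M1) (L M2) (L M3) _ _ (tens_map s) (tens_map t)).
  + exact: hom_map.
  + exact: tens_map_hom_over ht.
  + move=> x; rewrite tens_map_comp //.
    apply: (tens_ext (g := fun=> 0)) x => [||m e].
    * by apply: tens_map_linear => a u v; rewrite /= lf lg.
    * by move=> a u v; rewrite scaler0 addr0.
    rewrite tens_map_pure /=; last by move=> a u v; rewrite /= lf lg.
    by rewrite (_ : g (f m) = 0) ?(linfun0 (pure_linearl e)) //; apply/gf0; exists m.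
  + apply: (tens_ext (g := id)) => [a u v|//|m e].
      by rewrite !tens_map_linear // scalerDr addrACA.
    by rewrite !tens_map_pure // -(linfunD (pure_linearl e)) st.
- by move=> z; exists (tens_map t z); apply: tens_mapK z.
Qed.

(** * The adjunction between [L] and [F] *)

Section Adjunction.
Variables (M : rmodule Q) (V : rmodule G).

Definition uncurry (f : M -> F V) : L M -> V := tens_lift (fun m e => sp_val (f m) e).

Section Uncurry.
Variable f : M -> F V.
Hypothesis lf : linear f.

Lemma uncurry_linl e : linear (fun m => sp_val (f m) e).
Proof. by move=> a u v; rewrite lf. Qed.
Lemma uncurry_linr m : linear (sp_val (f m)).
Proof. by case: (sp_valP (f m)). Qed.

Lemma uncurry_linear : linear (uncurry f).
Proof. exact: (tens_lift_linear uncurry_linl uncurry_linr). Qed.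

Lemma uncurry_pure m e : uncurry f (pure m e) = sp_val (f m) e.
Proof. exact: (tens_lift_pure uncurry_linl uncurry_linr). Qed.

End Uncurry.

(** The conjugate of a map by [g], evaluated at [g e], is [g] applied to its value at [e]. *)
Lemma uncurry_hom f : hom M (F V) f -> hom (L M) V (uncurry f).
Proof.
move=> [lf ef]; split=> [|g _]; first exact: uncurry_linear.
apply: tens_ext => [a u v|a u v|m e].
- by rewrite [act g _](act_linear (r := L M)); apply: uncurry_linear.
- by rewrite uncurry_linear // act_linear.
rewrite [act g _]tens_act_pure !uncurry_pure // [act g m]/= ef //.
by rewrite homN_module_actE -actM mulVg act1.
Qed.

(** [N] acts trivially on the inflated module, so [n] sends [pure m e] to [pure m (n e)]. *)
Lemma curry_homN (h : L M -> V) m : hom (L M) V h ->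
  hom_over N E V (fun e => h (pure m e)).
Proof.
move=> [lh eh]; split=> [a u v|n Nn e]; first by rewrite pure_linearr lh.
rewrite -eh //= tens_act_pure /=.
by rewrite to_quotN // act1.
Qed.

Definition curry (h : L M -> V) (hh : hom (L M) V h) (m : M) : F V :=
  in_sp (curry_homN m hh).

Lemma curry_hom h (hh : hom (L M) V h) : hom M (F V) (curry hh).
Proof.
have [lh eh] := hh; split=> [a u v|X _ m]; apply: val_inj; apply/funext => e.
  by rewrite /= pure_linearl lh.
have [g ->] := to_quotP X.
rewrite [RHS]homN_module_actE /=.
by rewrite -eh //= tens_act_pure /= -actM mulgV act1.
Qed.

Lemma curryK h (hh : hom (L M) V h) : uncurry (curry hh) = h.
Proof.
apply/funext; apply: tens_ext => [||m e]; first 1 last.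
- exact: hh.1.
- by rewrite uncurry_pure //; exact: (curry_hom hh).1.
by apply: uncurry_linear; exact: (curry_hom hh).1.
Qed.

Lemma uncurry0 : uncurry 0 = 0.
Proof.
have l0 : linear (0 : M -> F V) by exact: (sp0 (hom M (F V))).1.
have l0' : linear (0 : L M -> V) by exact: (sp0 (hom (L M) V)).1.
apply/funext; apply: tens_ext => // [|m e]; first exact: uncurry_linear.
by rewrite uncurry_pure.
Qed.

Lemma uncurry_inj f g : linear f -> linear g -> uncurry f = uncurry g -> f = g.
Proof.
move=> lf lg fg; apply/funext => m; apply: val_inj; apply/funext => e.
by rewrite /= -!uncurry_pure // fg.
Qed.

End Adjunction.

(** An extension problem into [F I] is transposed to one into [I] along the tensored sequence, and
    its solution is curried back. *)
Lemma homN_rel_injective (I : rmodule G) :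
  rel_injective H I -> rel_injective QH (F I).
Proof.
move=> injI M1 M2 M3 d1 d2 ex f hf.
have [h hh hE] := injI _ _ _ _ _ (tensor_rel_short_exact ex) _ (uncurry_hom hf).
exists (curry hh); first exact: curry_hom.
apply/funext => m; apply: val_inj; apply/funext => e /=.
rewrite -(uncurry_pure hf.1) hE /= tens_map_pure //.
by have [[]] := ex.
Qed.

(** * Postcomposition on [F] and relative exactness *)

Section Postcomposition.
Variables (C : G -> Prop) (NC : forall g : G, N g -> C g) (V W : rmodule G).

(** The map [f] has to commute with [N] only. Hence [C] may be all of [G], for the differentials, or
    [H], for the contractions. *)
Lemma postcomp_homN (f : V -> W) (hf : hom_over C V W f) (u : F V) :
  hom_over N E W (f \o sp_val u).
Proof.
have [lu eu] := sp_valP u; have [lf ef] := hf.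
split=> [a x y|n Nn x] /=; first by rewrite lu lf.
by rewrite eu // ef //; apply: NC.
Qed.

Definition postcomp (f : V -> W) (hf : hom_over C V W f) (u : F V) : F W :=
  in_sp (postcomp_homN hf u).

Lemma postcomp_hom_over (CQ : Q -> Prop) f (hf : hom_over C V W f) :
  (forall X, CQ X -> exists2 g, C g & to_quot N g = X) ->
  hom_over CQ (F V) (F W) (postcomp hf).
Proof.
have [lf ef] := hf; move=> CQC; split=> [a u v|X /CQC [g Cg <-] u].
  by apply: val_inj; apply/funext => e; exact: lf.
apply: val_inj; apply/funext => e; rewrite [RHS]homN_module_actE /= -ef //.
by congr f; exact: homN_module_actE.
Qed.

End Postcomposition.
Arguments postcomp {C} NC {V W f} hf u.

Lemma postcomp_hom (V W : rmodule G) f (hf : hom V W f) :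
  hom (F V) (F W) (postcomp (fun _ _ => I) hf).
Proof.
by apply: postcomp_hom_over => X _; have [g ->] := to_quotP X; exists g.
Qed.

(** The contraction [s], [t] is [H]-equivariant, so [N <= H] lets it act by postcomposition; there
    it is an [H/N]-equivariant contraction. *)
Lemma homN_rel_exact (X Y Z T : rmodule G) (f : X -> Y) (g : Y -> Z)
    (h : Z -> T) (hf : hom X Y f) (hg : hom Y Z g) :
  direct_summand H (fun x => f x = 0) -> rel_exact_at H f g ->
  rel_exact_at H g h ->
  rel_exact_at QH (postcomp (fun _ _ => I) hf : F X -> F Y)
    (postcomp (fun _ _ => I) hg : F Y -> F Z).
Proof.
move=> sf fg gh; have [s [t [hs ht st]]] := rel_exact_contraction hf hg sf fg gh.
apply: (contraction_rel_exact (s := postcomp NH hs) (t := postcomp NH ht)).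
- exact: postcomp_hom.
- by apply: postcomp_hom_over => x.
- move=> u; apply: val_inj; apply/funext => e /=; apply/fg.1.
  by exists (sp_val u e).
by move=> u; apply: val_inj; apply/funext => e /=; exact: st.
Qed.

(** * The transported resolution and the isomorphism of complexes *)

Section Resolution.
Variables (V : rmodule G) (S : rel_resolution H V).

Definition homN_resolution : rel_resolution QH (F V).
refine (@RelResolution _ _ _ (F V) (fun n => F (res_obj S n))
  (postcomp (fun _ _ => I) (res_aug_hom S))
  (fun n => postcomp (fun _ _ => I) (res_d_hom S n)) _ _ _ _ _ _).
- exact: postcomp_hom.
- by move=> n; apply: postcomp_hom.
- move=> u v /(congr1 val) /= uv; apply: val_inj; apply/funext => e /=.
  by apply: (res_aug_inj (r := S)); exact: (congr1 (@^~ e) uv).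
- apply: homN_rel_exact (res_exact0 S) (res_exactS S 0).
  exact: direct_summand_inj (res_aug_hom S).1 (res_aug_inj (r := S)).
- move=> n; apply: homN_rel_exact (res_exactS S n) (res_exactS S n.+1).
  (* Exactness at a term records the splitting of the outgoing kernel: that of the first
     differential comes from [res_exact0], the later ones from [res_exactS]. *)
  by case: n => [|n]; [exact: (res_exact0 S).2|exact: (res_exactS S n).2].
- move=> n; apply: homN_rel_injective; exact: res_injective.
Defined.

Lemma relExt_homN_resolution (M : rmodule Q) n :
  lmod_iso (relExt homN_resolution M n) (relExt S (L M) n).
Proof.
(* Transposition commutes with the differentials, so it is a map of complexes. *)
have uncurry_d m (f : M -> F (res_obj S m)) : linear f -> forall t,
    uncurry (@res_d _ _ _ _ homN_resolution m \o f) t = @res_d _ _ _ _ S m (uncurry f t).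
  move=> lf; have [ldF _] := res_d_hom homN_resolution m.
  have [ld _] := res_d_hom S m.
  have ldf : linear (@res_d _ _ _ _ homN_resolution m \o f).
    by move=> a u v; rewrite /= lf; exact: ldF.
  apply: tens_ext => [|a u v|x e]; first exact: uncurry_linear.
    by rewrite uncurry_linear // ld.
  by rewrite !uncurry_pure.
have hdf m (f : M -> F (res_obj S m)) : hom M (F (res_obj S m)) f ->
    hom M (F (res_obj S m.+1)) (@res_d _ _ _ _ homN_resolution m \o f).
  by move=> hf; apply: hom_comp hf (res_d_hom homN_resolution m).
apply: (@subquot_iso _ _ _ _ _ _ _ (@uncurry M (res_obj S n))).
- move=> a f g [hf _] [hg _]; apply/funext.
  have hfg := spP (s := hom M (F (res_obj S n))) a hf hg.
  have hufg := spP (s := hom (L M) (res_obj S n)) a (uncurry_hom hf) (uncurry_hom hg).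
  apply: tens_ext => [||m e]; [exact: (uncurry_hom hfg).1|exact: hufg.1|].
  rewrite !fctE !uncurry_pure //; [exact: hg.1|exact: hf.1|exact: hfg.1].
- move=> f [hf df]; split; first exact: uncurry_hom.
  move=> t; rewrite -uncurry_d; last exact: hf.1.
  have -> : @res_d _ _ _ _ homN_resolution n \o f = 0 by apply/funext.
  by rewrite uncurry0.
- case: n => [|n] f [hf _]; have [lf _] := hf; split=> /=.
  + by move=> ->; exact: uncurry0.
  (* In degree 0 the only coboundary is 0, so the claim is the injectivity of transposition. *)
  + move=> fu; apply: uncurry_inj => //; last by rewrite uncurry0.
    exact: (sp0 (hom M (F (res_obj S 0)))).1.
  + move=> [g hg ->]; exists (uncurry g); first exact: uncurry_hom.
    by apply/funext; apply: uncurry_d; exact: hg.1.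
  (* If [uncurry f] is bounded by [h], then [f] is bounded by [curry hh], as both sides have the
     same transpose. *)
  move=> [h hh fh]; exists (curry hh); first exact: curry_hom.
  apply: uncurry_inj => //; first exact: (hdf _ _ (curry_hom hh)).1.
  rewrite fh; apply/funext => t; rewrite uncurry_d; last exact: (curry_hom hh).1.
  by rewrite curryK.
move=> h [hh dh]; exists (curry hh).
  split; first exact: curry_hom.
  move=> m; apply: val_inj; apply/funext => e; exact: dh.
rewrite curryK subrr; exact: sp0.
Qed.

End Resolution.
End Functors.

Theorem proposition6p4p1 (k : closedFieldType) (G : algGroup k)
    (N : normal_subgroup G) (H : closed_subgroup G)
    (NH : forall g : G, N g -> H g)
    (M : rmodule (quot_group N)) (E V : rmodule G) (finE : finite_dim E)
    (R : rel_resolution (quot_subgroup N H) (homN_module N V finE))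
    (S : rel_resolution H V) (n : nat) :
  lmod_iso (relExt R M n) (relExt S (tensor (inflate M) E) n).
Proof.
(* What remains is to compare [R] with [homN_resolution], two resolutions of the same module over
   [G/N]. *)
apply: lmod_iso_trans (relExt_homN_resolution NH finE S M n).
apply: relExt_resolution_independent; first exact: quot_regular_lin.
exact: quot_regular_translate.
Qed.
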